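(* Let $\mu\in(0,1)$ and let $\kappa>\lVert\nu^{\star}\rVert_{\infty}$ for some dual solution $\nu^{\star}$ of the convex program (P): $\min\{f(x)\mid h(x)=0_p,\ g(x)\le 0_m\}$. Let $L:\mathbb{R}^n\times\mathbb{R}^p\to\mathbb{R}$ be the augmented Lagrangian $$L(x,\lambda)=f(x)+\frac{1}{2\mu}\lVert h(x)\rVert^{2}+\langle\lambda,h(x)\rangle+\kappa\sum_{k=1}^{m}\max\{0,g_k(x)\}.$$ Then the set $\mathrm{sp}(L)$ of saddle points of $L$ is strongly globally asymptotically stable under the saddle-point dynamics $$\dot x\in-\partial_x L(x,\lambda),\qquad \dot\lambda\in\partial_\lambda L(x,\lambda)=\{h(x)\},\qquad (x(0),\lambda(0))=(x_0,\lambda_0)\in\mathbb{R}^n\times\mathbb{R}^p .$$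
   Context: Standing assumptions on (P): $f:\mathbb{R}^n\to\mathbb{R}$ is convex, $g=(g_1,\dots,g_m):\mathbb{R}^n\to\mathbb{R}^m$ is (componentwise) convex, neither necessarily differentiable; $h(x)=Ax-b$ with $A\in\mathbb{R}^{p\times n}$, $b\in\mathbb{R}^p$, $p\le n$. Put $C=\{x\in\mathbb{R}^n\mid h(x)=0_p,\ g(x)\le 0_m\}$ (componentwise inequality). The solution set $S=\{x^\star\in C\mid f(x^\star)=\inf_C f\}$ is nonempty and bounded. The strong Slater assumptions hold: (A1) $\mathrm{rank}(A)=p$; (A2) there is $x\in\mathbb{R}^n$ with $h(x)=0_p$ and $g_k(x)<0$ for all $k\in\{1,\dots,m\}$. Dual solution: $\nu^\star\in\mathbb{R}^m$ is the inequality-constraint part of a Lagrange dual optimal pair of (P), i.e. $\nu^\star\ge 0_m$ and there is $\lambda^\star\in\mathbb{R}^p$ with $\inf_{x\in\mathbb{R}^n}\{f(x)+\langle\lambda^\star,h(x)\rangle+\langle\nu^\star,g(x)\rangle\}=\inf_C f$. A saddle point of $L$ is a pair $(x^\star,\lambda^\star)$ with $L(x^\star,\lambda)\le L(x^\star,\lambda^\star)\le L(x,\lambda^\star)$ for all $x\in\mathbb{R}^n$, $\lambda\in\mathbb{R}^p$; $\mathrm{sp}(L)$ is the set of all of them. $\partial_xL(x,\lambda)$ is the subdifferential (equivalently, Clarke generalized gradient) of the convex function $L(\cdot,\lambda)$ at $x$; $\partial_\lambda L$ is the generalized gradient in $\lambda$. A solution of the dynamics is an absolutely continuous curve satisfying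 the inclusion for almost every $t$. $\lVert\cdot\rVert$ is the Euclidean norm, $\lVert\cdot\rVert_\infty$ the max norm. Strong global asymptotic stability of a set $M$ means that the following hold for all solutions (not merely some solution) of the differential inclusion: (stability) for each $\varepsilon>0$ there is $\delta>0$ such that every solution with $\mathrm{dist}((x_0,\lambda_0),M)<\delta$ satisfies $\mathrm{dist}((x(t),\lambda(t)),M)<\varepsilon$ for all $t\ge0$; (global attractivity) every maximal solution, from every initial condition in $\mathbb{R}^n\times\mathbb{R}^p$, is defined on $[0,+\infty)$ and satisfies $\mathrm{dist}((x(t),\lambda(t)),M)\to0$ as $t\to+\infty$. *)

(* Defs.v *)
From mathcomp Require Import all_boot all_order all_algebra.
From mathcomp Require Import all_classical all_reals all_analysis.
From mathcomp Require Import ring lra.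
Import Order.TTheory GRing.Theory Num.Theory.
Import numFieldNormedType.Exports.

Set Implicit Arguments.
Unset Strict Implicit.
Unset Printing Implicit Defensive.

Local Open Scope classical_set_scope.
Local Open Scope ring_scope.

(* The library norm `|x| on 'cV[R]_n is the max norm, and the one on a product
   is the max of the two norms; the Euclidean norms are defined here. *)
Section euclidean.
Context {R : realType}.

Definition dotv {n : nat} (u v : 'cV[R]_n) : R := \sum_i u i 0 * v i 0.

Definition enorm {n : nat} (u : 'cV[R]_n) : R := Num.sqrt (dotv u u).

Definition pnorm {n p : nat} (z : 'cV[R]_n * 'cV[R]_p) : R :=
  Num.sqrt (enorm z.1 ^+ 2 + enorm z.2 ^+ 2).

(* Extended-real valued, so that the distance to the empty set is +oo. *)
Definition edist_to {n p : nat} (M : set ('cV[R]_n * 'cV[R]_p))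
    (z : 'cV[R]_n * 'cV[R]_p) : \bar R :=
  ereal_inf [set (pnorm (z - w))%:E | w in M].

End euclidean.

Section gradients.
Context {R : realType} {n : nat}.

Definition subdifferential (f : 'cV[R]_n -> R) (x : 'cV[R]_n) :
    set 'cV[R]_n :=
  [set xi | forall y, f x + dotv xi (y - x) <= f y].

(* Clarke's directional derivative: the upper limit of
   (f (y + s v) - f y) / s as y tends to x and s decreases to 0. *)
Definition clarke_derivative (f : 'cV[R]_n -> R) (x v : 'cV[R]_n) : \bar R :=
  ereal_inf [set ereal_sup
      [set ((f (q.1 + q.2 *: v) - f q.1) / q.2)%:E
         | q in [set q : 'cV[R]_n * R | enorm (q.1 - x) < d /\ 0 < q.2 < d]]
    | d in [set d : R | 0 < d]].

Definition generalized_gradient (f : 'cV[R]_n -> R) (x : 'cV[R]_n) :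
    set 'cV[R]_n :=
  [set xi | forall v, ((dotv xi v)%:E <= clarke_derivative f x v)%E].

End gradients.

Section differential_inclusion.
Context {R : realType} {n p : nat}.
Implicit Types (z : R -> 'cV[R]_n * 'cV[R]_p) (J : set R).

Definition absolutely_continuous_on (a b : R) z :=
  forall e : R, 0 < e -> exists2 d : R, 0 < d &
    forall (k : nat) (u v : 'I_k -> R),
      (forall i, [/\ a <= u i, u i <= v i & v i <= b]) ->
      trivIset [set: 'I_k] (fun i => `]u i, v i[%classic) ->
      \sum_i (v i - u i) < d ->
      \sum_i pnorm (z (v i) - z (u i)) < e.

(* A curve is a total function of which only the restriction to the interval
   J matters.  J may or may not contain its right end point, if any; absolute
   continuity is required on the compact subintervals of J. *)
Definition is_solution (F : 'cV[R]_n * 'cV[R]_p -> set ('cV[R]_n * 'cV[R]_p))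
    J z :=
  [/\ [/\ is_interval J, J 0 & forall t, J t -> 0 <= t],
      forall a b, J a -> J b -> absolutely_continuous_on a b z &
      {ae @lebesgue_measure R, forall t : R, J t ->
        exists2 dz : 'cV[R]_n * 'cV[R]_p,
          is_derive (t : R^o) (1 : R^o) z dz & F (z t) dz}].

Definition is_maximal_solution
    (F : 'cV[R]_n * 'cV[R]_p -> set ('cV[R]_n * 'cV[R]_p)) J z :=
  is_solution F J z /\
  forall J' z', is_solution F J' z' -> J `<=` J' ->
    (forall t, J t -> z' t = z t) -> J' = J.

Definition strongly_stable
    (F : 'cV[R]_n * 'cV[R]_p -> set ('cV[R]_n * 'cV[R]_p))
    (M : set ('cV[R]_n * 'cV[R]_p)) :=
  forall e : R, 0 < e -> exists2 d : R, 0 < d &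
    forall J z, is_solution F J z ->
      (edist_to M (z 0%R) < d%:E)%E ->
      forall t, J t -> (edist_to M (z t) < e%:E)%E.

Definition strongly_globally_attractive
    (F : 'cV[R]_n * 'cV[R]_p -> set ('cV[R]_n * 'cV[R]_p))
    (M : set ('cV[R]_n * 'cV[R]_p)) :=
  forall J z, is_maximal_solution F J z ->
    J = `[0, +oo[%classic /\ edist_to M (z t) @[t --> +oo] --> 0%E.

Definition strongly_globally_asymptotically_stable
    (F : 'cV[R]_n * 'cV[R]_p -> set ('cV[R]_n * 'cV[R]_p))
    (M : set ('cV[R]_n * 'cV[R]_p)) :=
  strongly_stable F M /\ strongly_globally_attractive F M.

Definition saddle_points (L : 'cV[R]_n -> 'cV[R]_p -> R) :
    set ('cV[R]_n * 'cV[R]_p) :=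
  [set z | forall x l, L z.1 l <= L z.1 z.2 /\ L z.1 z.2 <= L x z.2].

Definition saddle_dynamics (L : 'cV[R]_n -> 'cV[R]_p -> R)
    (z : 'cV[R]_n * 'cV[R]_p) : set ('cV[R]_n * 'cV[R]_p) :=
  [set dz | [set - xi | xi in subdifferential (L ^~ z.2) z.1] dz.1 /\
            generalized_gradient (L z.1) z.2 dz.2].

End differential_inclusion.

Section convex_program.
Context {R : realType} {n m p : nat}.
Variables (f : 'cV[R]_n -> R) (g : 'cV[R]_n -> 'cV[R]_m).
Variables (A : 'M[R]_(p, n)) (b : 'cV[R]_p).

Definition eq_constraint (x : 'cV[R]_n) : 'cV[R]_p := A *m x - b.

Definition feasible_set : set 'cV[R]_n :=
  [set x | eq_constraint x = 0 /\ forall k, g x k 0 <= 0].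

(* The infimum is taken in the extended reals: the real-valued [inf] of a set
   that is not bounded below is 0. *)
Definition optimal_value : \bar R := ereal_inf [set (f x)%:E | x in feasible_set].

Definition solution_set : set 'cV[R]_n :=
  [set x | feasible_set x /\ (f x)%:E = optimal_value].

Definition dual_solution (nu : 'cV[R]_m) :=
  (forall k, 0 <= nu k 0) /\
  exists l : 'cV[R]_p,
    ereal_inf [set (f x + dotv l (eq_constraint x) + dotv nu (g x))%:E
                | x in [set: 'cV[R]_n]] = optimal_value.

Definition strong_slater :=
  \rank A = p /\
  exists x, eq_constraint x = 0 /\ forall k, g x k 0 < 0.

Definition augmented_lagrangian (mu kappa : R) (x : 'cV[R]_n) (l : 'cV[R]_p) : R :=
  f x + 1 / (2 * mu) * enorm (eq_constraint x) ^+ 2 + dotv l (eq_constraint x)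
  + kappa * \sum_k Num.max 0 (g x k 0).

Lemma generalized_gradient_augmented_lagrangian (mu kappa : R)
    (x : 'cV[R]_n) (l : 'cV[R]_p) :
  generalized_gradient (augmented_lagrangian mu kappa x) l =
  [set eq_constraint x].
Proof.
have dotC (u v : 'cV[R]_p) : dotv u v = dotv v u.
  by apply: eq_bigr => i _; rewrite mulrC.
have dotBl (u v w : 'cV[R]_p) : dotv (u - v) w = dotv u w - dotv v w.
  by rewrite /dotv -sumrB; apply: eq_bigr => i _; rewrite !mxE mulrBl.
have dotvv0 (u : 'cV[R]_p) : dotv u u <= 0 -> u = 0.
  move=> u0; apply/colP => i; rewrite mxE.
  have uu j : true -> 0 <= u j 0 * u j 0 by rewrite -expr2 sqr_ge0.
  have /eqP : dotv u u = 0 by apply/eqP; rewrite eq_le u0 sumr_ge0.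
  rewrite /dotv psumr_eq0// => /allP/(_ i); rewrite mem_index_enum.
  by move=> /(_ isT)/=; rewrite mulf_eq0 orbb => /eqP.
set h := eq_constraint x.
have quot (y v : 'cV[R]_p) (s : R) : 0 < s ->
    (augmented_lagrangian mu kappa x (y + s *: v)
     - augmented_lagrangian mu kappa x y) / s = dotv h v.
  move=> s0; rewrite /augmented_lagrangian -/h.
  have -> : dotv (y + s *: v) h = dotv y h + s * dotv h v.
    rewrite /dotv mulr_sumr -big_split; apply: eq_bigr => i _ /=.
    by rewrite !mxE; ring.
  set c := f x + _; set k := kappa * _.
  by field; rewrite lt0r_neq0.
have cd v : clarke_derivative (augmented_lagrangian mu kappa x) l v
    = (dotv h v)%:E.
  rewrite /clarke_derivative -[RHS](@ereal_inf1 R); congr ereal_inf.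
  have S d : 0 < d -> ereal_sup
      [set ((augmented_lagrangian mu kappa x (q.1 + q.2 *: v)
             - augmented_lagrangian mu kappa x q.1) / q.2)%:E
         | q in [set q : 'cV[R]_p * R | enorm (q.1 - l) < d /\ 0 < q.2 < d]]
      = (dotv h v)%:E.
    move=> d0; rewrite -[RHS](@ereal_sup1 R); congr ereal_sup.
    apply/seteqP; split => [_ [q [_ /andP[q0 _]] <-]|_ ->] /=.
      by rewrite quot.
    exists (l, d / 2) => /=; last by rewrite quot ?divr_gt0.
    rewrite subrr divr_gt0// ltr_pdivrMr// ltr_pMr// ltr1n; split=> //.
    by rewrite /enorm /dotv big1 ?sqrtr0// => i _; rewrite mxE mul0r.
  apply/seteqP; split => [_ [d /= d0 <-]|_ ->]; first exact: S.
  by exists 1 => /=; [exact: ltr01 | rewrite S].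
apply/seteqP; split => [xi /= xih|_ -> v /=]; last by rewrite cd.
apply/eqP; rewrite -subr_eq0; apply/eqP/dotvv0.
by rewrite dotBl subr_le0; have := xih (xi - h); rewrite cd lee_fin.
Qed.

End convex_program.

(* Main.v *)
From HB Require Import structures.
Require Import Defs.
From mathcomp Require Import all_boot all_order all_algebra.
From mathcomp Require Import all_classical all_reals all_analysis.
From mathcomp Require Import ring lra.
Import Order.TTheory GRing.Theory Num.Theory.
Import numFieldNormedType.Exports.
Local Open Scope classical_set_scope.
Local Open Scope ring_scope.

(** Put h x = A x - b and let phi be f plus both penalty terms, so that the
    augmented Lagrangian is L (x, l) = phi x + <l, h x>.  An optimal point xs and
    an optimal multiplier ls form a saddle point with quadratic growth,
    phi xs + |h x|^2 / (2 mu) <= L (x, ls), because kappa dominates the dual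
    solution nu [exact_penalty_growth].

    Everything is expressed through the gap
      G (w, z) = L (w.1, z.2) - L (z.1, w.2).
    A velocity v is admissible for the dynamics at z if and only if
    <v, z - w> <= G (w, z) for all w [saddle_dynamics_velocity], that is, if
    half the squared distance to each w decreases at least at rate - G (w, z).
    For fixed w both sides depend continuously on z and v, so this form survives
    limits.

    - Stability.  If w is a saddle point then G (w, .) <= 0, so the distance to
      w never increases along a solution [evi_solution_fejer]; delta = epsilon
      works.

    - Completeness.  As G (w, z) + G (z, w) = 0, two solutions never move apart
      and are determined by their starting point [evi_solution_unique].  A
      solution on the whole half-line starts at every point
      [evi_solution_exists]: the implicit Euler scheme is solvable by
      minimising a coercive convex function [proximal_saddle_point], its
      iterates stay in a ball, hence have uniformly bounded speed, and the step
      functions converge along an ultrafilter to a Lipschitz curve.  A Lipschitz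
      curve is differentiable almost everywhere [lipschitz_ae_derivable], and
      its derivative inherits the inequality.  A maximal solution therefore
      lives on the half-line.

    - Attraction.  G ((xs, ls), z (t)) tends to 0 [solution_gap_to_zero], so by
      quadratic growth the constraint violation h tends to 0.  Near a cluster
      point (x, l) the multiplier is then almost at rest over arbitrarily long
      time windows, while the primal part keeps approaching every y for which
      L (y, l) < L (x, l); as it is bounded, there is no such y, and (x, l) is a
      saddle point.  The distance to it being nonincreasing, the whole
      trajectory converges to (x, l) [solution_converges_to_saddle].

    The first-order arguments need one fact of real analysis: an absolutely
    continuous function whose derivative is almost everywhere at most c grows at
    most at rate c [ac_derive_le]. *)

Set Implicit Arguments.
Unset Strict Implicit.
Unset Printing Implicit Defensive.

(** * Euclidean geometry and finite convex functions *)

Section euclidean_space.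
Context {R : realType} {n : nat}.
Implicit Types (u v w : 'cV[R]_n) (k : R).

Lemma dotvC u v : dotv u v = dotv v u.
Proof. by apply: eq_bigr => i _; rewrite mulrC. Qed.

Lemma dotvDl u v w : dotv (u + v) w = dotv u w + dotv v w.
Proof. by rewrite /dotv -big_split; apply: eq_bigr => i _; rewrite !mxE mulrDl. Qed.

Lemma dotvZl k u v : dotv (k *: u) v = k * dotv u v.
Proof. by rewrite /dotv mulr_sumr; apply: eq_bigr => i _; rewrite !mxE mulrA. Qed.

Lemma dotvNl u v : dotv (- u) v = - dotv u v.
Proof. by rewrite -scaleN1r dotvZl mulN1r. Qed.

Lemma dotvDr u v w : dotv u (v + w) = dotv u v + dotv u w.
Proof. by rewrite dotvC dotvDl !(dotvC u). Qed.

Lemma dotvZr k u v : dotv u (k *: v) = k * dotv u v.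
Proof. by rewrite dotvC dotvZl dotvC. Qed.

Lemma dotvNr u v : dotv u (- v) = - dotv u v.
Proof. by rewrite dotvC dotvNl dotvC. Qed.

Definition dotvE := (dotvDl, dotvDr, dotvNl, dotvNr, dotvZl, dotvZr).

Lemma dotv0r u : dotv u 0 = 0.
Proof. by rewrite -(scale0r 0) dotvZr mul0r. Qed.

Lemma dotvv_ge0 u : 0 <= dotv u u.
Proof. by apply: sumr_ge0 => i _; rewrite -expr2 sqr_ge0. Qed.

Lemma enorm_ge0 u : 0 <= enorm u. Proof. exact: sqrtr_ge0. Qed.

Lemma sqr_enorm u : enorm u ^+ 2 = dotv u u.
Proof. by rewrite sqr_sqrtr// dotvv_ge0. Qed.

Lemma enorm0 : enorm (0 : 'cV[R]_n) = 0.
Proof. by rewrite /enorm dotv0r sqrtr0. Qed.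

Lemma enormN u : enorm (- u) = enorm u.
Proof. by rewrite /enorm dotvNl dotvNr opprK. Qed.

Lemma enormZ k u : enorm (k *: u) = `|k| * enorm u.
Proof.
by rewrite /enorm dotvZl dotvZr mulrA -expr2 sqrtrM ?sqr_ge0// sqrtr_sqr.
Qed.

Lemma enorm_distC u v : enorm (u - v) = enorm (v - u).
Proof. by rewrite -enormN opprB. Qed.

Lemma ler_coord_enorm u i : `|u i 0| <= enorm u.
Proof.
rewrite -sqrtr_sqr ler_wsqrtr// /dotv (bigD1 i)//= expr2 lerDl.
by apply: sumr_ge0 => j _; rewrite -expr2 sqr_ge0.
Qed.

Lemma enorm_eq0 u : enorm u = 0 -> u = 0.
Proof.
move=> u0; apply/colP => i; rewrite mxE; apply/eqP.
by rewrite -normr_eq0 eq_le normr_ge0 andbT -u0 ler_coord_enorm.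
Qed.

Lemma sqr_enormD u v :
  enorm (u + v) ^+ 2 = enorm u ^+ 2 + 2 * dotv u v + enorm v ^+ 2.
Proof. by rewrite !sqr_enorm !dotvE (dotvC v u); ring. Qed.

Lemma sqr_enormB u v :
  enorm (u - v) ^+ 2 = enorm u ^+ 2 - 2 * dotv u v + enorm v ^+ 2.
Proof. by rewrite sqr_enormD enormN dotvNr; ring. Qed.

Lemma cauchy_schwarz u v : dotv u v <= enorm u * enorm v.
Proof.
have [/enorm_eq0 ->|u0] := eqVneq (enorm u) 0.
  by rewrite enorm0 mul0r dotvC dotv0r.
have [/enorm_eq0 ->|v0] := eqVneq (enorm v) 0; first by rewrite enorm0 mulr0 dotv0r.
have u1 : 0 < enorm u by rewrite lt_def u0 enorm_ge0.
have v1 : 0 < enorm v by rewrite lt_def v0 enorm_ge0.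
have := dotvv_ge0 (enorm v *: u - enorm u *: v).
rewrite -sqr_enorm sqr_enormB !enormZ dotvZl dotvZr !ger0_norm ?enorm_ge0// => H.
rewrite -(ler_pM2l (mulr_gt0 u1 v1)); nra.
Qed.

Lemma ler_enormD u v : enorm (u + v) <= enorm u + enorm v.
Proof.
rewrite -(@ler_pXn2r _ 2)// ?nnegrE ?addr_ge0 ?enorm_ge0//.
by rewrite sqr_enormD sqrrD; have := cauchy_schwarz u v; lra.
Qed.

Lemma ler_enormB u v : enorm (u - v) <= enorm u + enorm v.
Proof. by rewrite -(enormN v) ler_enormD. Qed.

Lemma ler_enorm_trans w u v : enorm (u - v) <= enorm (u - w) + enorm (w - v).
Proof. by rewrite (le_trans _ (ler_enormD _ _))// addrA subrK. Qed.

Lemma ler_enorm_sum u : enorm u <= \sum_i `|u i 0|.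
Proof.
have s0 : 0 <= \sum_i `|u i 0| by apply: sumr_ge0.
rewrite -(@ler_pXn2r _ 2)// ?nnegrE ?enorm_ge0// sqr_enorm expr2 mulr_suml.
apply: ler_sum => i _; apply: le_trans (ler_norm _) _.
rewrite normrM ler_wpM2l// (bigD1 i)//= lerDl.
by apply: sumr_ge0.
Qed.

End euclidean_space.

(** Along an ultrafilter every bounded family converges, each coordinate by
    compactness of a segment.  This replaces the extraction of subsequences,
    also for uncountably many sequences at once. *)
Lemma bounded_ultralimit {R : realType} {n : nat} {I : Type} (U : set_system I)
    (UU : UltraFilter U) (w : I -> 'cV[R]_n) (B : R) :
  (forall j, enorm (w j) <= B) ->
  exists l, forall e, 0 < e -> U [set j | enorm (w j - l) < e].
Proof.
move=> wB.
have lim i : exists c : R, forall e, 0 < e -> U [set j | `|w j i 0 - c| < e].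
  have : compact (`[- B, B]%classic : set R) by exact: segment_compact.
  move=> /(_ (fmap (fun j => w j i 0) U) _) [|c [_ cl]].
    have wB' j : - B <= w j i 0 <= B.
      by rewrite -ler_norml; exact: le_trans (ler_coord_enorm (w j) i) (wB j).
    suff : U [set j | w j i 0 \in `[- B, B]] by [].
    by apply: filterE => j /=; rewrite in_itv/=.
  exists c => e e0.
  have [//|Un] := in_ultra_setVsetC [set j | `|w j i 0 - c| < e] UU.
  have [y [/= yn /= yc]] := cl [set y | ~ `|y - c| < e] _ Un (nbhsx_ballx c e e0).
  by case: yn; rewrite distrC.
have [l lP] := choice lim.
exists (\col_i l i) => e e0.
have e1 : 0 < e / n.+1%:R by rewrite divr_gt0.
have H : U [set j | forall i, `|w j i 0 - l i| < e / n.+1%:R].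
  by apply: filter_forall => i; exact: lP.
apply: filterS H => j /= H.
apply: le_lt_trans (ler_enorm_sum _) _.
have : \sum_i `|(w j - \col_i l i) i 0| <= \sum_(i < n) (e / n.+1%:R).
  by apply: ler_sum => i _; rewrite !mxE ltW.
move=> /le_lt_trans; apply.
rewrite sumr_const card_ord -[_ *+ _]mulr_natr mulrAC ltr_pdivrMr//.
by rewrite ltr_pM2l// ltr_nat.
Qed.

Section convex_on_space.
Context {R : realType} {n : nat}.
Implicit Types (phi : 'cV[R]_n -> R).

Definition convex phi := forall x y (t : R), 0 <= t <= 1 ->
  phi (t *: x + (1 - t) *: y) <= t * phi x + (1 - t) * phi y.

(** Induction on the number of nonzero coordinates: x is the midpoint of twice
    its last nonzero coordinate, where convexity on a segment gives a bound by
    the two end points, and of twice the remaining vector. *)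
Lemma convex_bounded_above phi (r : R) : convex phi ->
  exists B, forall x, enorm x <= r -> phi x <= B.
Proof.
move=> cphi.
have key (k : nat) : forall s : R, 0 < s -> exists B : R, forall x : 'cV[R]_n,
    (forall i, `|x i 0| <= s) -> (forall i : 'I_n, (k <= i)%N -> x i 0 = 0) ->
    phi x <= B.
  elim: k => [|k ih] s s0.
    exists (phi 0) => x _ x0; rewrite (_ : x = 0)//.
    by apply/colP => i; rewrite mxE x0.
  have [|B BP] := ih (2 * s); first lra.
  have [nk|kn] := leqP n k.
    exists B => x xs x0; apply: BP => i; first by have := xs i; lra.
    by move=> ki; have := ltn_ord i; rewrite ltnNge (leq_trans nk).
  pose o := Ordinal kn; pose e : 'cV[R]_n := delta_mx o 0.
  pose C := Num.max (phi ((2 * s) *: e)) (phi (- (2 * s) *: e)).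
  exists ((B + C) / 2) => x xs x0.
  have xo : `|x o 0| <= s by exact: xs.
  have C1 : phi ((2 * x o 0) *: e) <= C.
    pose t := (x o 0 + s) / (2 * s).
    have t01 : 0 <= t <= 1.
      move: xo; rewrite ler_norml => /andP[xo1 xo2].
      rewrite /t divr_ge0 ?ler_pdivrMr ?mulr_gt0//; lra.
    have -> : (2 * x o 0) *: e = t *: ((2 * s) *: e) + (1 - t) *: (- (2 * s) *: e).
      rewrite !scalerA -scalerDl; congr (_ *: _); rewrite /t; field.
      by rewrite gt_eqF.
    apply: le_trans (cphi _ _ _ t01) _.
    have : phi ((2 * s) *: e) <= C by rewrite le_max lexx.
    have : phi (- (2 * s) *: e) <= C by rewrite le_max lexx orbT.
    by move: t01 => /andP[]; nra.
  pose y := x - x o 0 *: e.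
  have yE i : y i 0 = if i == o then 0 else x i 0.
    rewrite !mxE eqxx andbT; case: eqVneq => [->|_]; last by rewrite mulr0 subr0.
    by rewrite mulr1 subrr.
  have C2 : phi (2 *: y) <= B.
    apply: BP => i.
      rewrite mxE yE normrM ger0_norm// ler_pM2l//.
      by case: ifP => _; [rewrite normr0 ltW|exact: xs].
    move=> ki; rewrite mxE yE; case: eqVneq => [_|io]; first by rewrite mulr0.
    rewrite x0 ?mulr0// ltn_neqAle ki andbT.
    by apply: contra io => /eqP ki'; apply/eqP/val_inj.
  have -> : x = (2^-1) *: (2 *: y) + (1 - 2^-1) *: ((2 * x o 0) *: e).
    rewrite !scalerA mulVf// scale1r /y.
    rewrite (_ : (1 - 2^-1) * (2 * x o 0) = x o 0) ?subrK//.
    by field.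
  apply: le_trans (cphi _ _ _ _) _; first lra.
  by lra.
have r0 : 0 < `|r| + 1 by rewrite ltr_wpDl.
have [B BP] := key n _ r0.
exists B => x xr; apply: BP => i.
  by rewrite (le_trans (ler_coord_enorm _ _))// (le_trans xr)// (le_trans (ler_norm r))// lerDl.
by move=> ni; have := ltn_ord i; rewrite ltnNge ni.
Qed.

(** The bound from above at - x yields one from below at x, because 0 is the
    midpoint of both. *)
Lemma convex_bounded phi (r : R) : convex phi ->
  exists B, forall x, enorm x <= r -> `|phi x| <= B.
Proof.
move=> cphi; have [B BP] := convex_bounded_above r cphi.
exists (Num.max B (B - 2 * phi 0)) => x xr.
have h1 := BP _ xr.
have h2 : phi (- x) <= B by apply: BP; rewrite enormN.
have := cphi x (- x) 2^-1.
rewrite [X in phi X](_ : _ = 0); last first.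
  by apply/colP => i; rewrite !mxE; lra.
move=> /(_ ltac:(lra)) h3.
by rewrite ler_norml lerNl !le_max; apply/andP; split; apply/orP; [right; lra|left].
Qed.

(** The value at y of a convex function lies below the chord from x to a point
   one unit beyond y, which turns a bound into a Lipschitz constant. *)
Lemma convex_lipschitz phi (r : R) : convex phi ->
  exists2 K, 0 <= K & forall x y, enorm x <= r -> enorm y <= r ->
    phi y - phi x <= K * enorm (y - x).
Proof.
move=> cphi; have [B BP] := convex_bounded (r + 1) cphi.
have [r0|r0] := ltP r 0.
  exists 0 => // x y xr; have := enorm_ge0 x; lra.
have B0 : 0 <= B by apply: le_trans (BP 0 _); rewrite ?enorm0//; lra.
exists (2 * B); first lra.
move=> x y xr yr; set d := enorm (y - x).
have [/enorm_eq0/eqP|dn0] := eqVneq d 0.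
  by rewrite subr_eq0 => /eqP ->; rewrite subrr mulr_ge0 ?enorm_ge0; lra.
have d0 : 0 < d by rewrite lt_def dn0 enorm_ge0.
pose z := y + d^-1 *: (y - x).
have zr : enorm z <= r + 1.
  apply: le_trans (ler_enormD _ _) _; rewrite enormZ -/d ger0_norm ?invr_ge0 ?(ltW d0)//.
  by rewrite mulVf// lerD2r.
pose t := d / (1 + d).
have t0 : 0 <= t <= d.
  by rewrite /t divr_ge0 ?ler_pdivrMr//; nra.
have t1 : t <= 1 by rewrite /t ler_pdivrMr; lra.
have := cphi z x t.
have -> : t *: z + (1 - t) *: x = y.
  apply/colP => i; rewrite !mxE /t; field.
  by rewrite dn0/=; lra.
move=> /(_ ltac:(lra)) h.
have hx : `|phi x| <= B by apply: BP; lra.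
have hz : `|phi z| <= B by exact: BP.
move: hx hz; rewrite !ler_norml => /andP[hx1 hx2] /andP[hz1 hz2].
move: t0 => /andP[t0 td]; nra.
Qed.

End convex_on_space.

(** * Absolutely continuous curves *)

Lemma ae_lebesgueS {R : realType} (P Q : R -> Prop) : (forall t, P t -> Q t) ->
  {ae @lebesgue_measure R, forall t, P t} -> {ae @lebesgue_measure R, forall t, Q t}.
Proof.
move=> PQ; apply: filterS PQ.
exact: (ae_filter_ringOfSetsType (@lebesgue_measure R)).
Qed.

(** Continuous induction, by looking at the supremum of the points reached; it
    takes the place of a covering of the segment by finitely many intervals. *)
Lemma real_induction {R : realType} (P : R -> Prop) (a b : R) : a <= b -> P a ->
  (forall T, a <= T <= b -> exists2 d, 0 < d &
    (forall u, a <= u <= T -> T - d < u -> P u -> P T) /\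
    (forall v, T <= v <= b -> v < T + d -> P T -> P v)) ->
  P b.
Proof.
move=> ab Pa H; pose S := [set t | a <= t <= b /\ P t].
have Sa : S a by split; rewrite // lexx.
have Sub : ubound S b by move=> t [/andP[]].
have supS : has_sup S by split; [exists a|exists b].
pose T := sup S.
have aT : a <= T by exact: sup_upper_bound.
have Tb : T <= b by apply: sup_le_ub => //; exists a.
have [d d0 [H1 H2]] := H T ltac:(by rewrite aT).
have [u [/andP[au ub] Pu] ut] := sup_adherent d0 supS.
have uT : u <= T by apply: sup_upper_bound => //; split; rewrite ?au.
have PT : P T by apply: (H1 u) => //; rewrite au.
have [bT|Tb'] := leP b T; first by rewrite (_ : b = T)//; apply/eqP; rewrite eq_le bT Tb.
pose v := Num.min b (T + d / 2).
have Tv : T < v by rewrite lt_min Tb' ltrDl divr_gt0.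
have vb : v <= b by rewrite ge_min lexx.
have : v <= T.
  apply: sup_upper_bound => //; split; first by rewrite vb (le_trans aT)// ltW.
  apply: H2 => //; first by rewrite vb ltW.
  by rewrite gt_min; apply/orP; right; lra.
by rewrite leNgt Tv.
Qed.

Lemma is_derive_approx {R : realType} {V : normedModType R} (f : R -> V) (t : R) (v : V) :
  is_derive (t : R^o) (1 : R^o) (f : R^o -> V) v -> forall e, 0 < e ->
  exists2 d, 0 < d & forall s, `|s - t| < d -> `|f s - f t - (s - t) *: v| <= e * `|s - t|.
Proof.
move=> [df dfE] e e0.
have := df; rewrite /derivable => /cvg_ex[l lP].
have lv : l = v by rewrite -dfE; apply/esym/cvg_lim.
subst l.
move/cvgrPdist_le : lP => /(_ _ e0); rewrite near_withinE => -[d /= d0 dP].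
exists d => // s sd.
have [->|st] := eqVneq s t; first by rewrite !subrr scale0r subr0 !normr0 mulr0.
have /= := dP (s - t); rewrite sub0r normrN sd subr_eq0 st => /(_ isT isT).
rewrite -[(s - t) *: 1]/((s - t) * 1) mulr1 subrK => H.
have -> : f s - f t - (s - t) *: v =
    (s - t) *: ((s - t)^-1 *: (f s - f t) - v).
  by rewrite scalerBr scalerA mulfV ?scale1r// subr_eq0.
by rewrite normrZ mulrC ler_wpM2r// -normrN opprB.
Qed.

Section absolute_continuity.
Context {R : realType}.
Implicit Types (a b c : R) (D : R -> R -> R).

(** Absolute continuity of a curve depends only on the size [D u v] of its
    increment from time u to time v, which allows one treatment of scalar
    curves, curves in a Euclidean space and curves in a product. *)
Definition ac_incr a b D :=
  forall e : R, 0 < e -> exists2 d : R, 0 < d &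
    forall (k : nat) (u v : 'I_k -> R),
      (forall i, [/\ a <= u i, u i <= v i & v i <= b]) ->
      trivIset [set: 'I_k] (fun i => `]u i, v i[%classic) ->
      \sum_i (v i - u i) < d ->
      \sum_i D (u i) (v i) < e.

Lemma le_ac_incr a b D1 D2 (K : R) :
  (forall u v, a <= u -> u <= v -> v <= b -> D2 u v <= K * D1 u v) ->
  (forall u v, 0 <= D1 u v) ->
  ac_incr a b D1 -> ac_incr a b D2.
Proof.
move=> D21 D10 H e e0; have K0 : 0 < `|K| + 1 by rewrite ltr_wpDl.
have [d d0 P] := H (e / (`|K| + 1)) (divr_gt0 e0 K0).
exists d => // k u v uv tuv sd; have := P k u v uv tuv sd.
rewrite ltr_pdivlMr// mulr_suml; apply: le_lt_trans; apply: ler_sum => i _.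
have [? ? ?] := uv i; apply: le_trans (D21 _ _ _ _ _) _ => //.
by rewrite mulrC ler_wpM2l// (le_trans (ler_norm _))// lerDl.
Qed.

Lemma ac_incrD a b D1 D2 : ac_incr a b D1 -> ac_incr a b D2 ->
  ac_incr a b (fun u v => D1 u v + D2 u v).
Proof.
move=> H1 H2 e e0.
have [d1 d10 P1] := H1 (e / 2) ltac:(lra); have [d2 d20 P2] := H2 (e / 2) ltac:(lra).
exists (Num.min d1 d2); first by rewrite lt_min d10.
move=> k u v uv tuv; rewrite lt_min => /andP[sd1 sd2]; rewrite big_split/=.
by have := P1 k u v uv tuv sd1; have := P2 k u v uv tuv sd2; lra.
Qed.

(** Lists of successive intervals, unlike families indexed by an ordinal, are
    easily extended by one interval. *)
Lemma ac_incr_seq a b D : ac_incr a b D ->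
  forall e : R, 0 < e -> exists2 d : R, 0 < d & forall s : seq (R * R),
    pairwise (fun p q => p.2 <= q.1) s ->
    all (fun p => [&& a <= p.1, p.1 <= p.2 & p.2 <= b]) s ->
    \sum_(p <- s) (p.2 - p.1) < d -> \sum_(p <- s) D p.1 p.2 < e.
Proof.
move=> ac e /ac[d d0 H]; exists d => // s /(pairwiseP (0, 0)) sp /allP sab sd.
pose q (i : 'I_(size s)) := nth (0, 0) s i.
have qs i : q i \in s by exact: mem_nth.
have := H (size s) (fun i => (q i).1) (fun i => (q i).2).
rewrite (big_nth (0, 0)) big_mkord; apply.
- by move=> i; have /and3P[] := sab _ (qs i).
- have dis (i j : 'I_(size s)) : (i < j)%N ->
      `](q i).1, (q i).2[ `&` `](q j).1, (q j).2[ !=set0 -> False.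
    move=> ij [x /=]; rewrite !in_itv/= => -[/andP[_ x1] /andP[x2 _]].
    have := sp i j; rewrite !inE !ltn_ord => /(_ isT isT ij).
    by rewrite leNgt (lt_trans x2 x1).
  move=> i j _ _ ne; have [ij|ji|/val_inj//] := ltngtP i j.
    by case: (dis _ _ ij ne).
  by case: (dis _ _ ji); rewrite setIC.
by move: sd; rewrite (big_nth (0, 0)) big_mkord.
Qed.

Definition curve_incr (phi : R -> R) u v := `|phi v - phi u|.

(** Continuous induction along the segment.  Around a good point the increment
    of phi is at most (c + e) times the elapsed time.  The bad points lie in an
    open set U of small measure; the time intervals spent in U are collected in
    a list, and absolute continuity makes the total increment over them small. *)
Lemma ac_derive_le (a b c : R) (phi : R -> R) : a <= b ->
  ac_incr a b (curve_incr phi) ->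
  {ae @lebesgue_measure R, forall t, a <= t <= b ->
    exists2 d : R, is_derive (t : R^o) (1 : R^o) (phi : R^o -> R^o) d & d <= c} ->
  phi b - phi a <= c * (b - a).
Proof.
move=> ab ac [N [mN N0 NP]].
suff H e : 0 < e -> phi b - phi a <= c * (b - a) + e * (b - a + 2).
  apply/ler_addgt0Pr => e e0.
  have K0 : 0 < b - a + 2 by lra.
  by have := H (e / (b - a + 2)) (divr_gt0 e0 K0); rewrite divfK ?gt_eqF.
move=> e0; set ce := c + e.
have [d d0 dP] := ac_incr_seq ac e0.
pose d' := Num.min d (e / (`|ce| + 1)).
have d'0 : 0 < d' by rewrite lt_min d0 divr_gt0// ltr_wpDl.
have [U [oU NU UN]] := @lebesgue_regularity_outer R N d' mN ltac:(by rewrite [X in (X < _)%E]N0) d'0.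
have mU : measurable U by exact: measurable_realfun.open_measurable.
have Ud : (lebesgue_measure U < d'%:E)%E.
  rewrite -(setDUK NU) measureU//.
  - by rewrite [X in (X + _)%E]N0 add0e.
  - exact: measurableD.
  - by apply/seteqP; split => x // -[Nx [_ /(_ Nx)]].
(* The list s holds the intervals spent in U up to time t; its total length
   stays below the measure of U because they are disjoint. *)
pose P t := exists s : seq (R * R),
  [/\ pairwise (fun p q => p.2 <= q.1) s,
      all (fun p => [&& a <= p.1, p.1 <= p.2 & p.2 <= t]) s,
      ((\sum_(p <- s) (p.2 - p.1))%:E <= lebesgue_measure (U `&` `]a, t]))%E &
      phi t - phi a <= ce * (t - a) +
        \sum_(p <- s) (`|phi p.2 - phi p.1| + `|ce| * (p.2 - p.1))].
have step u t : a <= u -> u <= t -> P u ->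
    phi t - phi u <= ce * (t - u) \/ `]u, t] `<=` U -> P t.
  move=> au ut [s [s1 s2 s3 s4]] [h|h].
    exists s; split => //.
    - apply: sub_all s2 => p /and3P[-> -> /le_trans]; exact.
    - apply: le_trans s3 _; rewrite le_measure// ?inE; try exact: measurableI.
      by apply: setIS => x /=; rewrite !in_itv/= => /andP[-> /le_trans]; exact.
    - have := lerD h s4; lra.
  exists (rcons s (u, t)); split.
  - rewrite pairwise_rcons s1 andbT; apply: sub_all s2 => p /and3P[_ _]; exact.
  - rewrite all_rcons/= au ut lexx/=.
    apply: sub_all s2 => p /and3P[-> -> /le_trans]; exact.
  - rewrite -cats1 big_cat big_seq1/= EFinD.
    have -> : U `&` `]a, t] = (U `&` `]a, u]) `|` `]u, t].
      apply/seteqP; split=> x /=; rewrite !in_itv/=.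
        by move=> [Ux /andP[ax xt]]; have [xu|ux] := leP x u; [left; rewrite ax|right].
      move=> [[Ux /andP[ax xu]]|/andP[ux xt]]; first by rewrite ax (le_trans xu).
      by split; [apply: h; rewrite /= in_itv/= ux|rewrite xt (le_lt_trans au)].
    rewrite measureU//; last 2 first.
    - exact: measurableI.
    - apply/seteqP; split => x //=; rewrite !in_itv/= => -[[_ /andP[_ xu]] /andP[ux _]].
      by move: ux; rewrite ltNge xu.
    apply: leeD => //; rewrite [leRHS]lebesgue_measure_itv/= lte_fin.
    case: ltP => [_|tu]; first by rewrite EFinB.
    by rewrite lee_fin subr_le0.
  - rewrite -cats1 big_cat big_seq1/=.
    have := ler_norm (phi t - phi u).
    have := ler_norm (- ce); rewrite normrN; nra.
have Pb : P b.
  apply: (real_induction ab).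
    by exists [::]; split => //=; rewrite ?big_nil ?subrr ?mulr0 ?addr0.
  move=> T /andP[aT Tb].
  have [UT|UT] := pselect (U T).
    have /nbhs_ballP[d1 /= d10 d1P] := open_nbhs_nbhs (conj oU UT).
    exists d1 => //; split=> [u|v] /andP[].
      move=> au uT Tu Pu; apply: (step u) => //; right=> x/=; rewrite in_itv/=.
      by move=> /andP[ux xT]; apply: d1P => /=; rewrite /ball/= ger0_norm; lra.
    move=> Tv vb vT PT; apply: (step T) => //; right=> x/=; rewrite in_itv/=.
    by move=> /andP[ux xT]; apply: d1P => /=; rewrite /ball/= ltr0_norm; lra.
  have [v dv vc] : exists2 d : R, is_derive (T : R^o) (1 : R^o) (phi : R^o -> R^o) d & d <= c.
    apply: contrapT => nT; apply: UT; apply: NU; apply: NP => /=.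
    by rewrite aT Tb => /(_ isT).
  have [d1 d10 d1P] := is_derive_approx dv e0.
  exists d1 => //; split=> [u|w] /andP[].
    move=> au uT Tu Pu; apply: (step u) => //; left.
    have /= := d1P u; rewrite ler0_norm ?subr_le0// => /(_ ltac:(lra)).
    rewrite -[(u - T) *: v]/((u - T) * v) ler_norml => /andP[h1 _].
    by rewrite /ce; nra.
  move=> Tw wb wT PT; apply: (step T) => //; left.
  have /= := d1P w; rewrite ger0_norm ?subr_ge0// => /(_ ltac:(lra)).
  rewrite -[(w - T) *: v]/((w - T) * v) ler_norml => /andP[_ h1].
  by rewrite /ce; nra.
have [s [s1 s2 s3 s4]] := Pb.
have sd : \sum_(p <- s) (p.2 - p.1) < d'.
  rewrite -lte_fin; apply: le_lt_trans s3 _; apply: le_lt_trans Ud.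
  by rewrite le_measure ?inE//; exact: measurableI.
move: sd; rewrite lt_min => /andP[sd sd'].
have := dP s s1 s2 sd; rewrite /curve_incr => H1.
move: s4; rewrite big_split/= -mulr_sumr.
move: sd'; rewrite ltr_pdivlMr ?ltr_wpDl// => H2.
set x := \sum_(p <- s) (p.2 - p.1) in H2 *.
have x0 : 0 <= x.
  rewrite /x big_seq; apply: sumr_ge0 => p /(allP s2)/and3P[_ ? _].
  by rewrite subr_ge0.
by rewrite /ce in H2 *; nra.
Qed.

End absolute_continuity.

(** * Almost everywhere differentiability of Lipschitz functions *)

Section lipschitz_derivable.
Context {R : realType}.
Local Notation leb := (@lebesgue_measure R).

(** Both measures are infima over the same covers by half-open intervals, and
    on such an interval the first is at most K times the second. *)
Lemma lebesgue_stieltjes_dominated (F : cumulative R R) (K : R) : 0 < K ->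
  (forall x y, x <= y -> F y - F x <= K * (y - x)) ->
  forall A, leb A = 0%E -> lebesgue_stieltjes_measure F A = 0%E.
Proof.
move=> K0 FK A A0; apply/eqP; rewrite eq_le; apply/andP; split; last first.
  exact: (mu_ext_ge0 (wlength_ge0 F)).
apply/lee_addgt0Pr => e e0; rewrite add0e.
have : (leb A < (e / K)%:E)%E by rewrite [X in (X < _)%E]A0 lte_fin divr_gt0.
rewrite /lebesgue_measure /lebesgue_stieltjes_measure /measure_extension.
move=> /ereal_inf_lt[_ [B [mB AB] <-] sB].
apply: (@le_trans _ _ (\sum_(k <oo) wlength F (B k))%E).
  by apply: ereal_inf_lbound; exists B.
apply: (@le_trans _ _ (\sum_(k <oo) (K%:E * wlength idfun (B k)))%E).
  apply: lee_nneseries => [n *|n *]; first exact: wlength_ge0.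
  have := mB n; rewrite /measurable/= => /ocitvP[->|[[x y]/= xy ->]].
    by rewrite !wlength0 mule0.
  rewrite !(wlength_itv_bnd _ _ _ (ltW xy))/= -EFinM lee_fin; exact: FK (ltW xy).
rewrite nneseriesZl; last by move=> n _; exact: (wlength_ge0 idfun).
by rewrite muleC -lee_pdivlMr// ltW.
Qed.


(** Adding a multiple of t makes f nondecreasing without losing the Lipschitz
    property.  The Lebesgue-Stieltjes measure of the sum is then absolutely
    continuous, so the sum is the indefinite integral of a Radon-Nikodym
    density, which Lebesgue's differentiation theorem differentiates.  The
    measure is restricted to a bounded interval to make it finite. *)
Lemma lipschitz_ae_derivable_itv (f : R -> R) (M : R) (n : nat) :
  (forall x y, `|f y - f x| <= M * `|y - x|) ->
  {ae leb, forall t, - n%:R < t < n%:R -> derivable (f : R^o -> R^o) t 1}.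
Proof.
move=> fM; pose M' := `|M| + 1.
have M'0 : 0 < M' by rewrite ltr_wpDl.
have {}fM x y : x <= y -> - (M' * (y - x)) <= f y - f x <= M' * (y - x).
  move=> xy; rewrite -ler_norml; apply: le_trans (fM _ _) _.
  by rewrite [`|y - x|]ger0_norm ?subr_ge0// ler_wpM2r ?subr_ge0// (le_trans (ler_norm _))// lerDl.
pose F t := f t + M' * t.
have Fnd : nondecreasing F.
  by move=> x y xy; have := fM _ _ xy; rewrite /F; nra.
have FK x y : x <= y -> F y - F x <= 2 * M' * (y - x).
  by move=> xy; have := fM _ _ xy; rewrite /F; nra.
have Fcont : continuous (F : R -> R).
  move=> x; apply/cvgrPdist_le => e e0.
  apply/nbhs_ballP; exists (e / (2 * M')) => /=; first by rewrite divr_gt0// mulr_gt0.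
  move=> y; rewrite /ball/= ltr_pdivlMr ?mulr_gt0// => xy.
  have [le|/ltW le] := leP x y.
    have := FK _ _ le; have := Fnd _ _ le; move: xy.
    rewrite ler0_norm ?subr_le0//; rewrite ler_norml; nra.
  have := FK _ _ le; have := Fnd _ _ le; move: xy.
  rewrite ger0_norm ?subr_ge0//; rewrite ler_norml; nra.
pose Fc : cumulative R R := HB.pack F (isCumulative.Build R _ R F Fnd (right_continuousW Fcont)).
pose D : set (measurableTypeR R) := `]- n%:R, n%:R]%classic.
have mD : @measurable _ (measurableTypeR R) D by exact: measurable_itv.
have LSE a b : a <= b -> lebesgue_stieltjes_measure Fc `]a, b]%classic = (F b - F a)%:E.
  move=> ab; rewrite /lebesgue_stieltjes_measure /measure_extension.
  by rewrite measurable_mu_extE/=; [exact: wlength_itv_bnd|exact: is_ocitv].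
have nn : - n%:R <= n%:R :> R by rewrite (@le_trans _ _ 0)// oppr_le0.
have Doo : (lebesgue_stieltjes_measure Fc D < +oo)%E by rewrite LSE// ltry.
pose nu : {finite_measure set (measurableTypeR R) -> \bar R} := mfrestr mD Doo.
have dom : nu `<< leb.
  apply/null_content_dominatesP => A mA A0; rewrite /nu /= /mfrestr /mrestr.
  apply: (@lebesgue_stieltjes_dominated Fc (2 * M')) => //; first by rewrite mulr_gt0.
  by apply: subset_measure0 A0 => //; exact: measurableI.
have [g [g0 gfin gint gE]] := @radon_nikodym_sigma_finite _ _ R leb nu dom.
pose h x := fine (g x).
have hg : EFin \o h = g by apply/funext => x; rewrite /= fineK.
have hint : leb.-integrable setT (EFin \o h) by rewrite hg.
have hloc : locally_integrable setT h.
  by apply: open_integrable_locally => //; exact: openT.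
have hi y : leb.-integrable [set` Interval (BRight (- n%:R)) (BRight y)] (EFin \o h).
  by apply: integrableS hint => //; exact: measurable_itv.
apply: ae_lebesgueS (FTC1 hi hloc) => t H /andP[nt tn].
have {H}[dI _] := H nt.
set I := fun y => _ in dI.
have IE y : - n%:R < y < n%:R -> I y = F y - F (- n%:R).
  move=> /andP[/ltW ny yn]; rewrite /I /Rintegral.
  under eq_integral do rewrite -[(h _)%:E]/((EFin \o h) _) hg.
  rewrite -gE; last exact: measurable_itv.
  rewrite /nu/= /mfrestr /mrestr (_ : _ `&` D = `]- n%:R, y]%classic) ?LSE//.
  apply/seteqP; split=> x; rewrite /D /= !in_itv/=; first by case.
  by move=> /andP[-> xy]; rewrite xy (le_trans xy)// ltW.
have Id : derivable (fun y => I y + (cst (F (- n%:R)) y - M' *: y) : R^o) (t : R^o) 1.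
  apply: derivableD; first exact: dI.
  by apply: derivableB.
apply: near_eq_derivable Id.
have nt' : t \in `]- n%:R, n%:R[ by rewrite in_itv/= nt.
apply: filterS (near_in_itvoo nt') => y; rewrite in_itv/= => /IE ->.
by rewrite /F /cst/= -[M' *: y]/(M' * y); ring.
Qed.

Theorem lipschitz_ae_derivable (f : R -> R) (M : R) :
  (forall x y, `|f y - f x| <= M * `|y - x|) ->
  {ae leb, forall t, derivable (f : R^o -> R^o) t 1}.
Proof.
move=> fM; have H n := lipschitz_ae_derivable_itv n fM.
have := negligible_bigcup H; apply: negligibleS => t /= nt.
exists (Num.bound `|t|) => //= H1; apply: nt; apply: H1.
by rewrite -ltr_norml archi_boundP.
Qed.

End lipschitz_derivable.

(** * Velocities and distances of curves *)

Section curves.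
Context {R : realType} {N : nat}.
Implicit Types (u : R -> 'cV[R]_N) (v w z : 'cV[R]_N).

Lemma sqr_enorm_incr_le z w : enorm z ^+ 2 - enorm w ^+ 2 <= 2 * dotv (z - w) z.
Proof.
have := dotvv_ge0 (z - w); rewrite !sqr_enorm !dotvE (dotvC w z); lra.
Qed.

Lemma sqr_enorm_lip z w :
  `|enorm z ^+ 2 - enorm w ^+ 2| <= enorm (z - w) * (enorm z + enorm w).
Proof.
rewrite subr_sqr normrM ler_pM//; last by rewrite ger0_norm// addr_ge0 ?enorm_ge0.
rewrite ler_norml; apply/andP; split.
  by have := ler_enormD (w - z) z; rewrite subrK enorm_distC; lra.
by have := ler_enormD (z - w) w; rewrite subrK; lra.
Qed.

Definition has_velocity u t v :=
  forall i, is_derive (t : R^o) (1 : R^o) ((fun s => u s i 0) : R^o -> R^o) (v i 0).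

Lemma has_velocity_cst w t : has_velocity (cst w) t 0.
Proof. by move=> i; rewrite mxE; exact: is_derive_cst. Qed.

Lemma is_derive_dotv u1 u2 t v1 v2 : has_velocity u1 t v1 -> has_velocity u2 t v2 ->
  is_derive (t : R^o) (1 : R^o) ((fun s => dotv (u1 s) (u2 s)) : R^o -> R^o)
    (dotv v1 (u2 t) + dotv (u1 t) v2).
Proof.
move=> d1 d2.
have -> : (fun s => dotv (u1 s) (u2 s)) =
    \sum_(i < N) (((fun s => u1 s i 0) : R^o -> R^o) * (fun s => u2 s i 0) : R^o -> R^o).
  by apply/funext => s; rewrite fct_sumE.
have := @is_derive_sum R R^o R^o N _ t 1 _ (fun i => is_deriveM (d1 i) (d2 i)).
move=> D; apply: (is_derive_eq D); rewrite /dotv -big_split/=; apply: eq_bigr => i _.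
rewrite -[u1 t i 0 *: v2 i 0]/(u1 t i 0 * v2 i 0).
by rewrite -[u2 t i 0 *: v1 i 0]/(u2 t i 0 * v1 i 0); ring.
Qed.

Lemma has_velocityB u1 u2 t v1 v2 : has_velocity u1 t v1 -> has_velocity u2 t v2 ->
  has_velocity (fun s => u1 s - u2 s) t (v1 - v2).
Proof.
move=> d1 d2 i.
have -> : (fun s => (u1 s - u2 s) i 0) =
    ((fun s => u1 s i 0) : R^o -> R^o) - (fun s => u2 s i 0).
  by apply/funext => s; rewrite !mxE.
by rewrite !mxE; exact: is_deriveB.
Qed.

Lemma is_derive_sqr_dist u1 u2 t v1 v2 : has_velocity u1 t v1 -> has_velocity u2 t v2 ->
  is_derive (t : R^o) (1 : R^o) ((fun s => enorm (u1 s - u2 s) ^+ 2) : R^o -> R^o)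
    (2 * dotv (v1 - v2) (u1 t - u2 t)).
Proof.
move=> d1 d2; have d := has_velocityB d1 d2.
have -> : (fun s => enorm (u1 s - u2 s) ^+ 2) = (fun s => dotv (u1 s - u2 s) (u1 s - u2 s)).
  by apply/funext => s; rewrite sqr_enorm.
apply: is_derive_eq (is_derive_dotv d d) _.
by rewrite [X in _ + X]dotvC; ring.
Qed.

Definition enorm_incr u s t := enorm (u t - u s).

Lemma ac_incr_cst w a b : ac_incr a b (enorm_incr (cst w)).
Proof.
by move=> e e0; exists 1 => // k x y _ _ _; rewrite big1// => i _; rewrite /enorm_incr subrr enorm0.
Qed.

Lemma ac_incr_bounded u a b : a <= b -> ac_incr a b (enorm_incr u) ->
  exists r, forall t, a <= t <= b -> enorm (u t) <= r.
Proof.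
move=> ab /(_ 1 ltr01)[d d0 H].
have step s t : a <= s -> s <= t -> t <= b -> t - s < d -> enorm (u t) <= enorm (u s) + 1.
  move=> sa st tb std.
  have := H 1%N (fun=> s) (fun=> t); rewrite !big_ord1 => /(_ _ _ std) h.
  have {}h : enorm_incr u s t < 1.
    by apply: h => // i j; rewrite (ord1 i) (ord1 j).
  by have := ler_enormD (u t - u s) (u s); rewrite subrK; move: h; rewrite /enorm_incr; lra.
have P k : forall t, a <= t -> t <= b -> t <= a + k%:R * (d / 2) -> enorm (u t) <= enorm (u a) + k%:R.
  elim: k => [|k ih] t ta tb tk.
    by rewrite (_ : t = a) ?addr0//; apply/eqP; rewrite eq_le ta andbT; move: tk; rewrite mul0r addr0.
  have [tk'|tk'] := leP t (a + k%:R * (d / 2)).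
    by rewrite (le_trans (ih _ ta tb tk'))// lerD2l ler_nat.
  have k0 : 0 <= k%:R * (d / 2) by rewrite mulr_ge0// divr_ge0// ltW.
  have hk : enorm (u (a + k%:R * (d / 2))) <= enorm (u a) + k%:R.
    by apply: ih => //; lra.
  have td : t - (a + k%:R * (d / 2)) < d by move: tk; rewrite -natr1; lra.
  have := step (a + k%:R * (d / 2)) t ltac:(lra) ltac:(lra) tb td.
  by rewrite -natr1; lra.
pose k := Num.bound ((b - a) / (d / 2)).
exists (enorm (u a) + k%:R) => t /andP[ta tb]; apply: P => //.
have : (b - a) / (d / 2) < k%:R.
  by apply: archi_boundP; rewrite divr_ge0//; lra.
by rewrite ltr_pdivrMr ?divr_gt0//; lra.
Qed.

(** The energy estimate behind contraction and stability.  Both curves are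
    bounded on the segment, so their squared distance is again absolutely
    continuous, and its derivative is twice the inner product of the relative
    velocity and the relative position. *)
Lemma sqr_dist_le u1 u2 (a b c : R) : a <= b ->
  ac_incr a b (enorm_incr u1) -> ac_incr a b (enorm_incr u2) ->
  {ae @lebesgue_measure R, forall t, a <= t <= b -> exists v1 v2,
    [/\ has_velocity u1 t v1, has_velocity u2 t v2 &
        dotv (v1 - v2) (u1 t - u2 t) <= c]} ->
  enorm (u1 b - u2 b) ^+ 2 - enorm (u1 a - u2 a) ^+ 2 <= 2 * c * (b - a).
Proof.
move=> ab ac1 ac2 H.
have [r1 r1P] := ac_incr_bounded ab ac1; have [r2 r2P] := ac_incr_bounded ab ac2.
apply: (ac_derive_le (phi := fun s => enorm (u1 s - u2 s) ^+ 2)) => //.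
  apply: (le_ac_incr (K := 2 * (r1 + r2)) _ _ (ac_incrD ac1 ac2)).
    move=> s t sa st tb; rewrite /curve_incr /enorm_incr.
    apply: le_trans (sqr_enorm_lip _ _) _; rewrite mulrC; apply: ler_pM.
    - by rewrite addr_ge0 ?enorm_ge0.
    - exact: enorm_ge0.
    - have := ler_enormB (u1 t) (u2 t); have := ler_enormB (u1 s) (u2 s).
      have := r1P t ltac:(lra); have := r1P s ltac:(lra).
      have := r2P t ltac:(lra); have := r2P s ltac:(lra); lra.
    - rewrite (_ : _ - _ - _ = (u1 t - u1 s) - (u2 t - u2 s)) ?ler_enormB//.
      by apply/colP => i; rewrite !mxE; ring.
  by move=> s t; rewrite addr_ge0 ?enorm_ge0.
apply: ae_lebesgueS H => t H /H[v1 [v2 [d1 d2 vc]]].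
by exists (2 * dotv (v1 - v2) (u1 t - u2 t)); [exact: is_derive_sqr_dist|rewrite ler_pM2l].
Qed.

End curves.

(** * Flows given by evolution variational inequalities *)

Section evolution.
Context {R : realType} {N : nat}.
Variable G : 'cV[R]_N -> 'cV[R]_N -> R.
Implicit Types (u : R -> 'cV[R]_N) (v w z : 'cV[R]_N).

(** For a smooth curve with velocity v at z, the inequality says that half the
    squared distance to w changes at rate at most G w z.  For a suitable G it
    characterises the velocities of a monotone differential inclusion. *)
Definition evi_velocity z v := forall w, dotv v (z - w) <= G w z.

Definition evi_solution (J : set R) u :=
  (forall a b, J a -> J b -> ac_incr a b (enorm_incr u)) /\
  {ae @lebesgue_measure R, forall t, J t ->
    exists2 v, has_velocity u t v & evi_velocity (u t) v}.

Definition evi_monotone := forall w z, G w z + G z w <= 0.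

Definition evi_bounded := forall r, exists B, forall w z,
  enorm w <= r -> enorm z <= r -> G w z <= B.

Definition evi_lipschitz := forall r w, exists2 K, 0 <= K & forall z z',
  enorm z <= r -> enorm z' <= r -> G w z' - G w z <= K * enorm (z' - z).

(** Solvability of one implicit Euler step of length s from z. *)
Definition evi_resolvent := forall s z, 0 < s -> exists z', forall w,
  dotv (z' - z) (z' - w) <= s * G w z'.

Definition evi_equilibrium w := forall z, G w z <= 0.

(** Testing with the point w at unit distance from z against the direction of v
    isolates the length of v. *)
Lemma evi_velocity_bounded (r : R) : evi_bounded -> exists2 M, 0 < M &
  forall z v, enorm z <= r -> evi_velocity z v -> enorm v <= M.
Proof.
move=> /(_ (r + 1))[B BP]; exists (`|B| + 1); first by rewrite ltr_wpDl.
move=> z v zr vz.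
have [->|v0] := eqVneq (enorm v) 0; first by rewrite addr_ge0.
have vp : 0 < enorm v by rewrite lt_def v0 enorm_ge0.
have := vz (z - (enorm v)^-1 *: v).
rewrite opprB addrC subrK dotvZr -sqr_enorm expr2 mulKf// => /le_trans; apply.
apply: le_trans (_ : B <= _); last by rewrite (le_trans (ler_norm _))// lerDl.
apply: BP; last lra.
apply: le_trans (ler_enormB _ _) _; rewrite enormZ ger0_norm ?invr_ge0 ?enorm_ge0//.
by rewrite mulVf//; lra.
Qed.

Lemma evi_solutionS (J J' : set R) u : J `<=` J' -> evi_solution J' u -> evi_solution J u.
Proof.
move=> JJ [ac d]; split=> [a b /JJ Ja /JJ Jb|]; first exact: ac.
by apply: ae_lebesgueS d => t H /JJ.
Qed.

Lemma evi_solution_dist_le J u w (a b c : R) : is_interval J -> evi_solution J u ->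
  J a -> J b -> a <= b -> (forall t, a <= t <= b -> G w (u t) <= c) ->
  enorm (u b - w) ^+ 2 - enorm (u a - w) ^+ 2 <= 2 * c * (b - a).
Proof.
move=> iJ [acu du] Ja Jb ab Gc.
apply: (sqr_dist_le (u2 := cst w)) => //; [exact: acu|exact: ac_incr_cst|].
apply: ae_lebesgueS du => t H tab; have [v dv vG] := H (iJ _ _ Ja Jb t tab).
exists v, 0; split => //; first exact: has_velocity_cst.
by rewrite subr0; apply: le_trans (vG w) (Gc _ tab).
Qed.

Lemma evi_solution_fejer J u w (a b : R) : is_interval J -> evi_solution J u ->
  evi_equilibrium w -> J a -> J b -> a <= b -> enorm (u b - w) <= enorm (u a - w).
Proof.
move=> iJ su ew Ja Jb ab.
have := evi_solution_dist_le iJ su Ja Jb ab (fun t _ => ew (u t)).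
by rewrite mulr0 mul0r subr_le0 ler_pXn2r ?nnegrE ?enorm_ge0.
Qed.

(** Testing the velocity of each curve at the position of the other and adding
    shows that two solutions never move apart. *)
Lemma evi_solution_unique J u1 u2 (a b : R) : evi_monotone -> is_interval J ->
  evi_solution J u1 -> evi_solution J u2 -> J a -> J b -> a <= b ->
  u1 a = u2 a -> u1 b = u2 b.
Proof.
move=> mG iJ [ac1 d1] [ac2 d2] Ja Jb ab uab.
have : enorm (u1 b - u2 b) ^+ 2 - enorm (u1 a - u2 a) ^+ 2 <= 2 * 0 * (b - a).
  apply: sqr_dist_le => //; [exact: ac1|exact: ac2|].
  have /(_ _ _ _ _ d1 d2) := @filterS2 _ _ (ae_filter_ringOfSetsType (@lebesgue_measure R)).
  apply=> t /= H1 H2 tab.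
  have [v1 dv1 V1] := H1 (iJ _ _ Ja Jb t tab); have [v2 dv2 V2] := H2 (iJ _ _ Ja Jb t tab).
  exists v1, v2; split => //.
  have := V1 (u2 t); have := V2 (u1 t); have := mG (u1 t) (u2 t).
  by rewrite !dotvE; lra.
rewrite uab subrr enorm0 expr0n subr0 mulr0 mul0r => h.
apply/eqP; rewrite -subr_eq0; apply/eqP/enorm_eq0/eqP.
by rewrite -sqrf_eq0 eq_le h sqr_ge0.
Qed.

Lemma evi_solution_dotv_le J u (e : 'cV[R]_N) (a b c : R) : is_interval J ->
  evi_solution J u -> J a -> J b -> a <= b ->
  (forall t v, a <= t <= b -> evi_velocity (u t) v -> dotv e v <= c) ->
  dotv e (u b - u a) <= c * (b - a).
Proof.
move=> iJ [acu du] Ja Jb ab ec.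
rewrite dotvDr dotvNr.
apply: (ac_derive_le (phi := fun t => dotv e (u t))) => //.
  apply: (le_ac_incr (K := enorm e) _ _ (acu _ _ Ja Jb)) => [x y _ _ _|x y]; last exact: enorm_ge0.
  rewrite /curve_incr /enorm_incr -dotvNr -dotvDr ler_norml cauchy_schwarz andbT.
  by rewrite lerNl -dotvNr -(enormN (u y - u x)) cauchy_schwarz.
apply: ae_lebesgueS du => t H tab; have Jt := iJ _ _ Ja Jb t tab; have [v dv vG] := H Jt.
exists (dotv e v); last exact: ec vG.
have ce : has_velocity (cst e) t 0 by exact: has_velocity_cst.
by apply: is_derive_eq (is_derive_dotv ce dv) _; rewrite dotvC dotv0r add0r.
Qed.

Lemma evi_solution_lipschitz J u (a b r M : R) : is_interval J -> evi_solution J u ->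
  0 <= M -> (forall z v, enorm z <= r -> evi_velocity z v -> enorm v <= M) ->
  (forall t, J t -> enorm (u t) <= r) -> J a -> J b -> a <= b ->
  enorm (u b - u a) <= M * (b - a).
Proof.
move=> iJ su M0 MP ur Ja Jb ab; set e := u b - u a.
have [->|e0] := eqVneq (enorm e) 0; first by rewrite mulr_ge0 ?subr_ge0.
have ep : 0 < enorm e by rewrite lt_def e0 enorm_ge0.
rewrite -(ler_pM2l ep) -expr2 sqr_enorm mulrA.
apply: (evi_solution_dotv_le iJ su) => // t v tab vG.
apply: le_trans (cauchy_schwarz _ _) _; rewrite ler_pM2l//.
by apply: MP vG; apply: ur; exact: iJ Ja Jb _ tab.
Qed.

Section implicit_euler.
Hypotheses (bG : evi_bounded) (lG : evi_lipschitz) (rG : evi_resolvent).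
Variables (w0 z0 : 'cV[R]_N).
Hypothesis ew0 : evi_equilibrium w0.

(** The implicit Euler scheme.  An implicit step does not increase the distance
    to the equilibrium w0, so the iterates stay in a ball that does not depend
    on the mesh size s, and on this ball velocities are bounded. *)
Lemma evi_scheme (s r M : R) : 0 < s ->
  (forall z v, enorm z <= r -> evi_velocity z v -> enorm v <= M) ->
  enorm w0 + enorm (z0 - w0) <= r ->
  exists zs : nat -> 'cV[R]_N, [/\ zs 0%N = z0,
    forall k, enorm (zs k) <= r,
    forall k, enorm (zs k.+1 - zs k) <= M * s &
    forall k w, enorm (zs k.+1 - w) ^+ 2 - enorm (zs k - w) ^+ 2
                <= 2 * (s * G w (zs k.+1))].
Proof.
move=> s0 MP zr.
have [S SP] := choice (fun z => rG z s0).
pose zs k := iter k S z0.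
have evi k w : enorm (zs k.+1 - w) ^+ 2 - enorm (zs k - w) ^+ 2
                <= 2 * (s * G w (zs k.+1)).
  apply: le_trans (sqr_enorm_incr_le _ _) _; rewrite ler_pM2l//.
  by rewrite opprB addrA subrK; exact: SP.
have fejer k : enorm (zs k - w0) <= enorm (z0 - w0).
  elim: k => [//|k ih]; apply: le_trans ih.
  rewrite -(@ler_pXn2r _ 2)// ?nnegrE ?enorm_ge0// -subr_le0.
  apply: le_trans (evi k w0) _; have := ew0 (zs k.+1); nra.
have zsr k : enorm (zs k) <= r.
  have := ler_enormD (zs k - w0) w0; rewrite subrK; have := fejer k; lra.
exists zs; split => // k.
have -> : zs k.+1 - zs k = s *: (s^-1 *: (zs k.+1 - zs k)).
  by rewrite scalerA mulfV ?scale1r// gt_eqF.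
rewrite enormZ gtr0_norm// mulrC ler_pM2r//; apply: MP (zsr k.+1) _ => w.
by rewrite dotvZl mulrC ler_pdivrMr// mulrC; exact: SP.
Qed.

(** One run of the scheme, read as a step function of time.  The last property
    is the evolution inequality summed over the steps between two times; the
    rounding of times to the grid costs one step. *)
Lemma evi_step_curve (h r M : R) : 0 < h -> 0 < M ->
  (forall z v, enorm z <= r -> evi_velocity z v -> enorm v <= M) ->
  enorm w0 + enorm (z0 - w0) <= r ->
  exists v : R -> 'cV[R]_N, [/\ v 0 = z0,
    forall t, enorm (v t) <= r,
    forall s t, s <= t -> enorm (v t - v s) <= M * (t - s + h) &
    forall s t w C, 0 <= s -> s <= t ->
      (forall x, enorm x <= r -> enorm (x - v s) <= M * (t - s + h) -> G w x <= C) ->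
      enorm (v t - w) ^+ 2 - enorm (v s - w) ^+ 2 <= 2 * (C * (t - s) + `|C| * h)].
Proof.
move=> h0 M0 MP zr; have [zs [zs0 zsr zsM zsE]] := evi_scheme h0 MP zr.
(* Negative times are sent to 0, which gives curves that are defined on the
   whole line. *)
pose idx (t : R) := Num.truncn (Num.max 0 t / h).
have idxP t : (idx t)%:R * h <= Num.max 0 t < (idx t)%:R * h + h.
  have : 0 <= Num.max 0 t / h by rewrite divr_ge0 ?(ltW h0)// le_max lexx.
  move=> /Num.Theory.truncn_itv /andP[h1 h2].
  rewrite -ler_pdivlMr// h1/= -[X in _ + X]mul1r -mulrDl -ltr_pdivrMr//.
  by rewrite natr1.
have idx_le s t : s <= t -> (idx s <= idx t)%N.
  move=> st; apply: le_truncn; rewrite ler_pM2r ?invr_gt0//.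
  by rewrite ge_max !le_max lexx st orbT.
have zs_lip k l : (k <= l)%N -> enorm (zs l - zs k) <= M * (l%:R * h - k%:R * h).
  elim: l => [|l ih]; first by rewrite leqn0 => /eqP ->; rewrite !subrr enorm0 mulr0.
  rewrite leq_eqVlt => /orP[/eqP ->|]; first by rewrite !subrr enorm0 mulr0.
  rewrite ltnS => /ih kl.
  have := ler_enorm_trans (zs l) (zs l.+1) (zs k).
  by have := zsM l; rewrite -natr1; lra.
exists (fun t => zs (idx t)); split => //.
- by rewrite /idx maxxx mul0r truncn0.
- move=> s t st; apply: le_trans (zs_lip _ _ (idx_le _ _ st)) _; rewrite ler_pM2l//.
  have max_lip : Num.max 0 t - Num.max 0 s <= t - s.
    by move: st; case: (leP 0 t) => ?; case: (leP 0 s) => ?; lra.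
  have /andP[_] := idxP s; have /andP[+ _] := idxP t; lra.
move=> s t w C s0 st CP.
have /andP[i0 i0'] := idxP s; have /andP[i1 i1'] := idxP t.
rewrite !max_r// in i0 i0' i1 i1'; last exact: le_trans st.
have window k : (idx s <= k)%N -> (k < idx t)%N -> G w (zs k.+1) <= C.
  move=> k0 k1; apply: CP => //.
  apply: le_trans (zs_lip _ _ (leq_trans k0 (leqnSn k))) _; rewrite ler_pM2l//.
  have : k.+1%:R * h <= (idx t)%:R * h by rewrite ler_pM2r// ler_nat.
  lra.
have telescope l : (idx s <= l)%N -> (l <= idx t)%N ->
    enorm (zs l - w) ^+ 2 - enorm (zs (idx s) - w) ^+ 2 <=
      2 * C * (l%:R * h - (idx s)%:R * h).
  elim: l => [|l ih].
    by rewrite leqn0 => /eqP l0 _; rewrite l0 !subrr mulr0.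
  rewrite leq_eqVlt => /orP[/eqP l0 _|]; first by rewrite l0 !subrr mulr0.
  rewrite ltnS => il li; have := ih il (ltnW li).
  have := zsE l w; have := window l il li.
  rewrite -(ler_pM2l h0) -natr1; lra.
have rounding : C * ((idx t)%:R * h - (idx s)%:R * h - (t - s)) <= `|C| * h.
  apply: le_trans (ler_norm _) _; rewrite normrM ler_wpM2l// ler_norml.
  by apply/andP; split; lra.
by have := telescope (idx t) (idx_le _ _ st) (leqnn _); lra.
Qed.

Lemma enorm_limit_le (a b : 'cV[R]_N) (c : R) :
  (forall e, 0 < e -> exists a' b', [/\ enorm (a' - a) < e, enorm (b' - b) < e &
     enorm (a' - b') <= c + e]) -> enorm (a - b) <= c.
Proof.
move=> H; apply/ler_addgt0Pr => e e0.
have [a' [b' [h1 h2 h3]]] := H (e / 3) ltac:(lra).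
have := ler_enorm_trans a' a b; have := ler_enorm_trans b' a' b.
by rewrite (enorm_distC a a'); lra.
Qed.

(** The step curves lie in a fixed ball, so at each time they have a limit along
    an ultrafilter on the mesh sizes.  Pointwise limits suffice because all
    estimates are uniform in the mesh size. *)
Lemma evi_limit_curve (r M : R) : 0 < M ->
  (forall z v, enorm z <= r -> evi_velocity z v -> enorm v <= M) ->
  enorm w0 + enorm (z0 - w0) <= r ->
  exists u : R -> 'cV[R]_N, [/\ u 0 = z0,
    forall s t, s <= t -> enorm (u t - u s) <= M * (t - s) &
    forall w t0 e, 0 <= t0 -> 0 < e -> exists2 d, 0 < d & forall t,
      t0 <= t -> t < t0 + d ->
      enorm (u t - w) ^+ 2 - enorm (u t0 - w) ^+ 2
        <= 2 * (t - t0) * (G w (u t0) + e)].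
Proof.
move=> M0 MP zr.
pose h (j : nat) : R := j.+1%:R^-1.
have h0 j : 0 < h j by rewrite invr_gt0.
have [uj ujP] := choice (fun j => evi_step_curve (h0 j) M0 MP zr).
have ujr j t : enorm (uj j t) <= r by have [_ + _ _] := ujP j; exact.
have [U [UU ooU]] := ultraFilterLemma eventually_filter.
have hU e : 0 < e -> U [set j | h j < e].
  by move=> e0; apply: ooU; exact: near_infty_natSinv_lt (PosNum e0).
have [u uP] := choice (fun t => bounded_ultralimit UU (fun j => ujr j t)).
have ur t : enorm (u t) <= r.
  rewrite -[u t]subr0; apply: enorm_limit_le => e e0.
  have [j /= jP] := filter_ex (uP t e e0).
  exists (uj j t), 0; split => //; first by rewrite subrr enorm0.
  by rewrite subr0; have := ujr j t; lra.
exists u; split.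
- apply/eqP; rewrite -subr_eq0; apply/eqP/enorm_eq0/eqP.
  rewrite eq_le enorm_ge0 andbT; apply: enorm_limit_le => e e0.
  have [j /= jP] := filter_ex (uP 0 e e0); have [uj0 _ _ _] := ujP j.
  exists (uj j 0), z0; split => //; first by rewrite subrr enorm0.
  by rewrite uj0 subrr enorm0; lra.
- move=> s t st; apply: enorm_limit_le => e e0.
  have [j [[/= j1 j2] j3]] := filter_ex (filterI (filterI (uP t e e0) (uP s e e0))
    (hU (e / M) (divr_gt0 e0 M0))).
  exists (uj j t), (uj j s); split => //; have [_ _ ujl _] := ujP j.
  by move: j3; rewrite /= ltr_pdivlMr//; have := ujl _ _ st; lra.
move=> w t0 e t00 e0; have [K K0 KP] := lG r w.
set C := G w (u t0) + e.
have KM : 0 <= K * M by rewrite mulr_ge0// ltW.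
(* Within time d the curve moves by M d, which changes G w by at most e / 2. *)
exists (e / (2 * (K * M + 1))); first by rewrite divr_gt0//; lra.
move=> t t0t; set d := e / _ => td.
have dK : 2 * (K * (M * d)) + 2 * d = e.
  rewrite -[RHS](@divfK _ (2 * (K * M + 1))) -/d; first by ring.
  by rewrite gt_eqF//; lra.
have d0 : 0 < d by rewrite divr_gt0//; lra.
pose Q := r + enorm w.
have B x : enorm x <= r -> 0 <= enorm (x - w) <= Q.
  by move=> xr; rewrite enorm_ge0 (le_trans (ler_enormB _ _))// lerD2r.
have Q0 : 0 <= Q by have /andP[] := B _ (ur t); exact: le_trans.
apply/ler_addgt0Pr => eta eta0.
have A1 : 0 < 2 * (K * (M + 1) + 1) by lra.
have A2 : 0 < 2 * `|C| + 4 * Q + 1 by have := normr_ge0 C; lra.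
(* The tolerance del bounds the mesh size and the distance to the limit: the
   first term keeps G w below C on the window, the second absorbs all rounding
   errors into eta. *)
pose del := Num.min (e / (2 * (K * (M + 1) + 1))) (eta / (2 * `|C| + 4 * Q + 1)).
have del0 : 0 < del by rewrite lt_min !divr_gt0.
have del1 : del * (2 * (K * (M + 1) + 1)) <= e.
  by rewrite -ler_pdivlMr// ge_min lexx.
have del2 : del * (2 * `|C| + 4 * Q + 1) <= eta.
  by rewrite -ler_pdivlMr// ge_min lexx orbT.
have [j [[/= j1 j2] /= j3]] := filter_ex
  (filterI (filterI (uP t del del0) (uP t0 del del0)) (hU del del0)).
have [_ _ _ ujE] := ujP j.
have window x : enorm x <= r -> enorm (x - uj j t0) <= M * (t - t0 + h j) ->
    G w x <= C.
  move=> xr xd.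
  have near : enorm (x - u t0) <= M * d + (M + 1) * del.
    have : M * (t - t0 + h j) <= M * (d + del) by rewrite ler_pM2l//; lra.
    have := ler_enorm_trans (uj j t0) x (u t0); lra.
  have := KP _ _ (ur t0) xr; have := ler_wpM2l K0 near.
  rewrite /C; clear -dK del1 e0 d0 del0; lra.
have main := ujE _ _ _ _ t00 t0t window.
have h1 := sqr_enorm_lip (u t - w) (uj j t - w).
rewrite opprB addrA subrK (enorm_distC (u t) (uj j t)) in h1.
have h2 := sqr_enorm_lip (uj j t0 - w) (u t0 - w); rewrite opprB addrA subrK in h2.
have b x y : enorm x <= r -> enorm y <= r -> enorm (x - y) <= del ->
    enorm (x - y) * (enorm (x - w) + enorm (y - w)) <= del * (2 * Q).
  move=> /B/andP[? ?] /B/andP[? ?] xy.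
  by apply: ler_pM; rewrite ?enorm_ge0 ?addr_ge0//; lra.
have b1 := b _ _ (ujr j t) (ur t) (ltW j1); rewrite [_ + enorm (u t - w)]addrC in b1.
have b2 := b _ _ (ujr j t0) (ur t0) (ltW j2).
have h3 : `|C| * h j <= `|C| * del by rewrite ler_wpM2l// ltW.
move: h1 h2; rewrite !ler_norml => /andP[_ h1] /andP[_ h2].
clear -main h1 h2 h3 b1 b2 del2 del0; lra.
Qed.

(** The limit curve is Lipschitz, hence differentiable almost everywhere.  At a
    point of differentiability, its growth to the right determines the derivative
    of the squared distance to w, and the inequality follows in the limit. *)
Theorem evi_solution_exists : exists2 u, u 0 = z0 & evi_solution `[0, +oo[ u.
Proof.
have [M M0 MP] := evi_velocity_bounded (enorm w0 + enorm (z0 - w0)) bG.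
have [u [u0 u_lip right_evi]] := evi_limit_curve M0 MP (lexx _).
exists u => //; split.
  move=> a b _ _; apply: (@le_ac_incr _ a b (fun s t => `|t - s|) _ M).
  - by move=> s t _ st _; rewrite ger0_norm ?subr_ge0// u_lip.
  - by move=> s t; exact: normr_ge0.
  - move=> e e0; exists e => // k x y xy _; apply: le_lt_trans.
    by apply: ler_sum => i _; have [_ ? _] := xy i; rewrite ger0_norm ?subr_ge0.
have u_ae i : {ae @lebesgue_measure R, forall t,
    derivable ((fun s => u s i 0) : R^o -> R^o) t 1}.
  apply: (lipschitz_ae_derivable (M := M)) => x y.
  wlog xy : x y / x <= y.
    move=> H; have [xy|/ltW yx] := leP x y; first exact: H.
    by rewrite distrC (distrC y); exact: H.
  rewrite [`|y - x|]ger0_norm ?subr_ge0//; apply: le_trans (u_lip _ _ xy).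
  by have := ler_coord_enorm (u y - u x) i; rewrite !mxE.
have {}u_ae : {ae @lebesgue_measure R, forall t, forall i,
    derivable ((fun s => u s i 0) : R^o -> R^o) t 1}.
  exact: (@filter_forall _ _ _ _ (ae_filter_ringOfSetsType (@lebesgue_measure R)) u_ae).
apply: ae_lebesgueS u_ae => t dt; rewrite /= in_itv/= andbT => t_ge0.
pose v := \col_i ('D_1 ((fun s => u s i 0) : R^o -> R^o) t).
have dv : has_velocity u t v by move=> i; rewrite mxE; exact: derivableP.
exists v => // w.
have dw := is_derive_sqr_dist dv (has_velocity_cst w t).
apply/ler_addgt0Pr => e e0.
have [d1 d10 D1] := is_derive_approx dw e0.
have [d2 d20 D2] := right_evi w t (e / 2) t_ge0 ltac:(lra).
pose d := Num.min d1 d2 / 2.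
have dd : [/\ 0 < d, d < d1 & d < d2].
  by have := d10; rewrite /d; case: (leP d1 d2); split; lra.
have [dp dd1 dd2] := dd.
have := D1 (t + d); rewrite addrAC subrr add0r gtr0_norm// => /(_ dd1).
have := D2 (t + d) ltac:(lra) ltac:(lra).
rewrite addrAC subrr add0r subr0 -[d *: _]/(d * _) /cst ler_norml => h1 /andP[h2 _].
rewrite -(ler_pM2l dp); lra.
Qed.

End implicit_euler.

End evolution.

(** * Calculus and minima of convex functions *)

Section convex_calculus.
Context {R : realType} {n : nat}.
Implicit Types (phi psi : 'cV[R]_n -> R).

Lemma convexD phi psi : convex phi -> convex psi -> convex (fun x => phi x + psi x).
Proof.
move=> c1 c2 x y t t01; have := c1 x y t t01; have := c2 x y t t01; lra.
Qed.

Lemma convexZ (k : R) phi : 0 <= k -> convex phi -> convex (fun x => k * phi x).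
Proof. by move=> k0 c x y t t01; have := ler_wpM2l k0 (c x y t t01); lra. Qed.

Lemma convex_sum m (phi : 'I_m -> 'cV[R]_n -> R) :
  (forall k, convex (phi k)) -> convex (fun x => \sum_k phi k x).
Proof.
move=> c x y t t01; rewrite !mulr_sumr -big_split; apply: ler_sum => k _.
exact: c.
Qed.

Lemma convex_max0 phi : convex phi -> convex (fun x => Num.max 0 (phi x)).
Proof.
move=> c x y t t01; have := c x y t t01; move: (phi (_ + _)) => w.
have /andP[t0 t1] := t01; rewrite ge_max.
have : 0 <= Num.max 0 (phi x) by rewrite le_max lexx.
have : 0 <= Num.max 0 (phi y) by rewrite le_max lexx.
have : phi x <= Num.max 0 (phi x) by rewrite le_max lexx orbT.
have : phi y <= Num.max 0 (phi y) by rewrite le_max lexx orbT.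
move: (Num.max 0 (phi x)) (Num.max 0 (phi y)) => X Y.
by move=> hY hX Y0 X0 hw; apply/andP; split; nra.
Qed.

Lemma convex_affine p (A : 'M[R]_(p, n)) b l :
  convex (fun x => dotv l (A *m x - b)).
Proof.
move=> x y t _.
rewrite mulmxDr -!scalemxAr !dotvE; lra.
Qed.

Lemma convex_sqr_affine p (A : 'M[R]_(p, n)) b :
  convex (fun x => enorm (A *m x - b) ^+ 2).
Proof.
move=> x y t /andP[t0 t1].
have -> : A *m (t *: x + (1 - t) *: y) - b =
    t *: (A *m x - b) + (1 - t) *: (A *m y - b).
  by rewrite mulmxDr -!scalemxAr; apply/colP => i; rewrite !mxE; ring.
move: (A *m x - b) (A *m y - b) => u v.
have tt : 0 <= t * (1 - t) by rewrite mulr_ge0// subr_ge0.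
have := mulr_ge0 tt (dotvv_ge0 (u - v)); rewrite !sqr_enorm !dotvE (dotvC v u).
lra.
Qed.

(** A lower bound that grows like a square forces minimising sequences to stay
    in a ball. *)
Lemma coercive_minimum psi (c k : R) (y : 'cV[R]_n) : convex psi -> 0 < k ->
  (forall x, c + k * enorm (x - y) ^+ 2 <= psi x) ->
  exists x, forall x', psi x <= psi x'.
Proof.
move=> cpsi k0 H.
pose S := range psi; have S0 : S !=set0 by exists (psi y), y.
have lbS : has_lbound S.
  exists c => _ [x _ <-]; apply: le_trans (H x).
  by rewrite lerDl mulr_ge0 ?sqr_ge0// ltW.
have infS : has_inf S by split.
have ex (j : nat) : exists x, psi x < inf S + j.+1%:R^-1.
  have [_ [x _ <-]] := @inf_adherent _ S (j.+1%:R^-1) ltac:(by rewrite invr_gt0) infS.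
  by exists x.
have [w wP] := choice ex.
pose Q := (inf S + 1 - c) / k.
have wr j : enorm (w j) <= enorm y + (Q + 1).
  have := ler_enormD (w j - y) y; rewrite subrK => h.
  have hQ : enorm (w j - y) ^+ 2 <= Q.
    rewrite /Q ler_pdivlMr// mulrC.
    have := H (w j); have := wP j.
    have : j.+1%:R^-1 <= 1 :> R by rewrite invf_le1// ler1n.
    by move: (j.+1%:R^-1) => q; lra.
  by have := enorm_ge0 (w j - y); nra.
have [U [UU ooU]] := ultraFilterLemma eventually_filter.
have [x xP] := bounded_ultralimit UU wr.
exists x => x'; apply: (@le_trans _ _ (inf S)); last first.
  by apply: ge_inf => //; exists x'.
have [K K0 KP] := convex_lipschitz (enorm x + (enorm y + (Q + 1))) cpsi.
have Q1 : 0 <= enorm y + (Q + 1) by exact: le_trans (enorm_ge0 _) (wr 0%N).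
apply/ler_addgt0Pr => e e0.
have e2 : 0 < e / 2 by lra.
have eK : 0 < e / (2 * (K + 1)) by rewrite divr_gt0// mulr_gt0// ltr_wpDl.
have hj : U [set j : nat | j.+1%:R^-1 < e / 2].
  by apply: ooU; exact: near_infty_natSinv_lt (PosNum e2).
have [j [/= j1 j2]] := filter_ex (filterI (xP _ eK) hj).
have := KP (w j) x _ _.
have := wr j; have := enorm_ge0 x; have := enorm_ge0 (w j) => ? ? ?.
move=> /(_ ltac:(lra) ltac:(lra)).
move: j2 (wP j); move: (j.+1%:R^-1) => q; rewrite enorm_distC; move: j1; rewrite ltr_pdivlMr; last by rewrite mulr_gt0// ltr_wpDl.
by have := enorm_ge0 (w j - x); nra.
Qed.

End convex_calculus.

(** * The saddle gap of a Lagrangian with affine constraints *)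

Section block_vectors.
Context {R : realType} {n p : nat}.
Implicit Types z w : 'cV[R]_(n + p).

Lemma dotv_col z w :
  dotv z w = dotv (usubmx z) (usubmx w) + dotv (dsubmx z) (dsubmx w).
Proof.
rewrite /dotv big_split_ord/=; congr (_ + _); apply: eq_bigr => i _;
by rewrite !mxE.
Qed.

Lemma dotv_col_mx (x1 x2 : 'cV[R]_n) (l1 l2 : 'cV[R]_p) :
  dotv (col_mx x1 l1) (col_mx x2 l2) = dotv x1 x2 + dotv l1 l2.
Proof. by rewrite dotv_col !col_mxKu !col_mxKd. Qed.

Lemma enorm_usubmx z : enorm (usubmx z) <= enorm z.
Proof.
rewrite -(@ler_pXn2r _ 2)// ?nnegrE ?enorm_ge0// !sqr_enorm [leRHS]dotv_col.
by rewrite lerDl dotvv_ge0.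
Qed.

Lemma enorm_dsubmx z : enorm (dsubmx z) <= enorm z.
Proof.
rewrite -(@ler_pXn2r _ 2)// ?nnegrE ?enorm_ge0// !sqr_enorm [leRHS]dotv_col.
by rewrite lerDr dotvv_ge0.
Qed.

Lemma usubmxB z w : usubmx (z - w) = usubmx z - usubmx w.
Proof. by apply/colP => i; rewrite !mxE. Qed.

Lemma dsubmxB z w : dsubmx (z - w) = dsubmx z - dsubmx w.
Proof. by apply/colP => i; rewrite !mxE. Qed.

Lemma mulmx_enorm_le (A : 'M[R]_(p, n)) :
  exists2 C, 0 <= C & forall x, enorm (A *m x) <= C * enorm x.
Proof.
exists (\sum_i \sum_j `|A i j|).
  by apply: sumr_ge0 => i _; apply: sumr_ge0.
move=> x; apply: le_trans (ler_enorm_sum _) _; rewrite mulr_suml.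
apply: ler_sum => i _; rewrite mxE mulr_suml.
apply: le_trans (ler_norm_sum _ _ _) _; apply: ler_sum => j _.
by rewrite normrM ler_wpM2l// ler_coord_enorm.
Qed.

End block_vectors.

Section lagrangian.
Context {R : realType} {n p : nat}.
Variables (phi : 'cV[R]_n -> R) (A : 'M[R]_(p, n)) (b : 'cV[R]_p).
Hypothesis cphi : convex phi.

Local Notation affine := (eq_constraint A b).
Definition lagr x l := phi x + dotv l (affine x).

(** The point w is a saddle point exactly when this is nonpositive for every z.
    As the G of an evolution variational inequality, it treats the subgradient
    inclusion for x and the equation for the multiplier at once. *)
Definition gap (w z : 'cV[R]_(n + p)) :=
  lagr (usubmx w) (dsubmx z) - lagr (usubmx z) (dsubmx w).

Lemma affineB x y : affine x - affine y = A *m (x - y).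
Proof. by rewrite /eq_constraint mulmxBr opprB addrA subrK. Qed.

Lemma gap_monotone : evi_monotone gap.
Proof. by move=> w z; rewrite /gap; lra. Qed.

Lemma affine_bounded (r : R) :
  exists2 B, 0 <= B & forall x, enorm x <= r -> enorm (affine x) <= B.
Proof.
have [C C0 CP] := mulmx_enorm_le A.
exists (C * `|r| + enorm b); first by rewrite addr_ge0 ?enorm_ge0// mulr_ge0.
move=> x xr; apply: le_trans (ler_enormB _ _) _; rewrite lerD2r.
by rewrite (le_trans (CP x))// ler_wpM2l// (le_trans xr)// ler_norm.
Qed.

Lemma gap_bounded : evi_bounded gap.
Proof.
move=> r; have [B1 B1P] := convex_bounded r cphi; have [B2 B20 B2P] := affine_bounded r.
exists (2 * B1 + 2 * (`|r| * B2)) => w z wr zr.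
have hw := B1P _ (le_trans (enorm_usubmx w) wr).
have hz := B1P _ (le_trans (enorm_usubmx z) zr).
have inner l x : enorm l <= r -> enorm x <= r -> `|dotv l (affine x)| <= `|r| * B2.
  move=> lr xr.
  have key l' : enorm l' <= r -> dotv l' (affine x) <= `|r| * B2.
    move=> lr'; apply: le_trans (cauchy_schwarz _ _) _.
    by apply: ler_pM; rewrite ?enorm_ge0// ?B2P// (le_trans lr')// ler_norm.
  by rewrite ler_norml key// andbT lerNl -dotvNl key// enormN.
have i1 := inner _ _ (le_trans (enorm_dsubmx z) zr) (le_trans (enorm_usubmx w) wr).
have i2 := inner _ _ (le_trans (enorm_dsubmx w) wr) (le_trans (enorm_usubmx z) zr).
move: hw hz i1 i2; rewrite !ler_norml /gap /lagr.
by move=> /andP[? ?] /andP[? ?] /andP[? ?] /andP[? ?]; lra.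
Qed.

Lemma gap_lipschitz : evi_lipschitz gap.
Proof.
move=> r w; have [K K0 KP] := convex_lipschitz r cphi; have [C C0 CP] := mulmx_enorm_le A.
exists (enorm (affine (usubmx w)) + K + enorm (dsubmx w) * C).
  by rewrite !addr_ge0 ?enorm_ge0// mulr_ge0 ?enorm_ge0.
move=> z z' zr zr'.
have -> : gap w z' - gap w z = dotv (dsubmx (z' - z)) (affine (usubmx w)) +
   (phi (usubmx z) - phi (usubmx z')) + dotv (dsubmx w) (A *m usubmx (z - z')).
  rewrite /gap /lagr dsubmxB usubmxB -affineB !dotvE; ring.
have h1 := KP _ _ (le_trans (enorm_usubmx z') zr') (le_trans (enorm_usubmx z) zr).
have h2 := cauchy_schwarz (dsubmx (z' - z)) (affine (usubmx w)).
have h3 := cauchy_schwarz (dsubmx w) (A *m usubmx (z - z')).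
have h4 := enorm_dsubmx (z' - z); have h5 := enorm_usubmx (z - z').
have h6 := CP (usubmx (z - z')).
rewrite -usubmxB in h1; rewrite (enorm_distC z z') in h5.
have h7 := ler_wpM2r (enorm_ge0 (affine (usubmx w))) h4.
have h8 := ler_wpM2l K0 h5.
have h9 := ler_wpM2l (enorm_ge0 (dsubmx w)) (le_trans h6 (ler_wpM2l C0 h5)).
lra.
Qed.

Variables (xs : 'cV[R]_n) (ls : 'cV[R]_p) (c : R).
Hypothesis c0 : 0 < c.
Hypothesis hxs : affine xs = 0.
Hypothesis growth : forall x, phi xs + c * enorm (affine x) ^+ 2 <= lagr x ls.

(** The primal half of an implicit Euler step.  Inserting the new multiplier
    eta + s (A x - b) turns the implicit equation into the optimality condition
    of a convex problem in x with two quadratic terms; the saddle point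
    (xs, ls) gives the lower bound that makes it coercive. *)
Lemma proximal_saddle_point (s : R) (y : 'cV[R]_n) (eta : 'cV[R]_p) : 0 < s ->
  exists x, forall x', dotv (y - x) (x' - x) <=
    s * (lagr x' (eta + s *: affine x) - lagr x (eta + s *: affine x)).
Proof.
move=> s0.
pose q x := s / 2 * enorm (affine x) ^+ 2 + (2 * s)^-1 * enorm (1%:M *m x - y) ^+ 2.
pose psi x := lagr x eta + q x.
have cpsi : convex psi.
  apply: convexD; first by apply: convexD => //; exact: convex_affine.
  by apply: convexD; apply: convexZ; rewrite ?divr_ge0 ?invr_ge0 ?mulr_ge0 ?(ltW s0)//;
    exact: convex_sqr_affine.
have [||x xP] := @coercive_minimum _ _ psi
    (phi xs - (2 * s)^-1 * enorm (eta - ls) ^+ 2) (2 * s)^-1 y cpsi.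
- by rewrite invr_gt0 mulr_gt0.
- move=> x; rewrite /psi /q mul1mx addrA lerD2r.
  have h1 := growth x; have h2 : 0 <= c * enorm (affine x) ^+ 2.
    by rewrite mulr_ge0 ?sqr_ge0// ltW.
  have := dotvv_ge0 (eta - ls + s *: affine x).
  rewrite -sqr_enorm sqr_enormD enormZ (gtr0_norm s0) dotvZr => h3.
  have h4 : 0 <= (2 * s)^-1 by rewrite invr_ge0 mulr_ge0// ltW.
  have := mulr_ge0 h4 h3.
  have -> : (2 * s)^-1 * (enorm (eta - ls) ^+ 2 +
      2 * (s * dotv (eta - ls) (affine x)) + (s * enorm (affine x)) ^+ 2) =
    (2 * s)^-1 * enorm (eta - ls) ^+ 2 + dotv (eta - ls) (affine x) +
      s / 2 * enorm (affine x) ^+ 2 by field; rewrite gt_eqF.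
  by move: h1; rewrite /lagr !dotvE; lra.
exists x => x'; set d := x' - x; set l := eta + s *: affine x.
pose Q := s ^+ 2 / 2 * enorm (A *m d) ^+ 2 + enorm d ^+ 2 / 2.
have Q0 : 0 <= Q by rewrite addr_ge0 ?divr_ge0 ?sqr_ge0// mulr_ge0 ?divr_ge0 ?sqr_ge0.
have -> : s * (lagr x' l - lagr x l) =
    s * (lagr x' eta - lagr x eta) + s ^+ 2 * dotv (affine x) (A *m d).
  rewrite /lagr /l -affineB !dotvE; ring.
(* Comparison of the minimiser x with the point x + t d, divided by t. *)
have key t : 0 < t -> t <= 1 -> dotv (y - x) d <=
    s * (lagr x' eta - lagr x eta) + s ^+ 2 * dotv (affine x) (A *m d) + t * Q.
  move=> t0 t1.
  have := xP (t *: x' + (1 - t) *: x).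
  have cl : convex (fun x => lagr x eta) by apply: convexD => //; exact: convex_affine.
  have := cl x' x t; rewrite (ltW t0) t1 => /(_ isT) h1.
  rewrite /psi /q !mul1mx.
  have -> : affine (t *: x' + (1 - t) *: x) = affine x + t *: (A *m d).
    rewrite /eq_constraint /d mulmxBr mulmxDr -!scalemxAr.
    by apply/colP => i; rewrite !mxE; ring.
  have -> : t *: x' + (1 - t) *: x - y = (x - y) + t *: d.
    by rewrite /d; apply/colP => i; rewrite !mxE; ring.
  rewrite (sqr_enormD (affine x)) (sqr_enormD (x - y)) !enormZ (gtr0_norm t0) !dotvZr => h2.
  have h3 : 0 <= t * (s * (lagr x' eta - lagr x eta) + s ^+ 2 * dotv (affine x) (A *m d)
                     + dotv (x - y) d + t * Q).
    have s2 : 0 < 2 * s by lra.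
    have h1' := ler_wpM2l (ltW s0) h1.
    have h2' := ler_wpM2l (ltW s0) h2; rewrite -subr_ge0 in h2'; move: h2'.
    have -> : s * (lagr (t *: x' + (1 - t) *: x) eta +
        (s / 2 * (enorm (affine x) ^+ 2 + 2 * (t * dotv (affine x) (A *m d)) +
           (t * enorm (A *m d)) ^+ 2) +
         (2 * s)^-1 * (enorm (x - y) ^+ 2 + 2 * (t * dotv (x - y) d) + (t * enorm d) ^+ 2))) -
      s * (lagr x eta + (s / 2 * enorm (affine x) ^+ 2 + (2 * s)^-1 * enorm (x - y) ^+ 2)) =
      s * (lagr (t *: x' + (1 - t) *: x) eta - lagr x eta) +
      t * (s ^+ 2 * dotv (affine x) (A *m d) + dotv (x - y) d + t * Q).
      by rewrite /Q; field; rewrite gt_eqF.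
    lra.
  move: h3; rewrite pmulr_rge0// -(opprB y x) dotvNl; lra.
apply/ler_addgt0Pr => e e0.
pose t := Num.min 1 (e / (Q + 1)).
have t0 : 0 < t by rewrite lt_min ltr01 divr_gt0// ltr_wpDl.
have t1 : t <= 1 by rewrite ge_min lexx.
have te : t * (Q + 1) <= e by rewrite -ler_pdivlMr ?ltr_wpDl// ge_min lexx orbT.
by have := key t t0 t1; lra.
Qed.

Lemma gap_resolvent : evi_resolvent gap.
Proof.
move=> s z s0.
have [x xP] := proximal_saddle_point (usubmx z) (dsubmx z) s0.
set l := dsubmx z + s *: affine x in xP.
exists (col_mx x l) => w.
rewrite dotv_col !usubmxB !dsubmxB col_mxKu col_mxKd /gap col_mxKu col_mxKd.
have := xP (usubmx w); rewrite -(opprB x) -(opprB x (usubmx w)) dotvNl dotvNr opprK.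
rewrite [l - dsubmx z]addrAC subrr add0r => h.
have -> : dotv (s *: affine x) (l - dsubmx w) = s * (lagr x l - lagr x (dsubmx w)).
  rewrite /lagr dotvZl (dotvC (affine x)) dotvDl dotvNl; ring.
by lra.
Qed.

(** The quadratic growth, that is the quadratic penalty, makes the flow
    dissipate the constraint violation. *)
Lemma gap_equilibrium_growth z :
  gap (col_mx xs ls) z <= - (c * enorm (affine (usubmx z)) ^+ 2).
Proof.
rewrite /gap col_mxKu col_mxKd {1}/lagr hxs dotv0r.
have := growth (usubmx z); lra.
Qed.

Lemma saddle_equilibrium x l : affine x = 0 -> (forall y, phi x <= lagr y l) ->
  evi_equilibrium gap (col_mx x l).
Proof.
move=> hx H z; rewrite /gap col_mxKu col_mxKd {1}/lagr hx dotv0r.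
have := H (usubmx z); lra.
Qed.

(** Changing only the multiplier of w makes both sides of the inequality
    linear in the change, so that equality holds. *)
Lemma gap_velocity_dual z v : evi_velocity gap z v -> dsubmx v = affine (usubmx z).
Proof.
move=> vz; pose d := affine (usubmx z) - dsubmx v.
have := vz (z + col_mx 0 d).
rewrite opprD addrA subrr sub0r dotvNr dotv_col col_mxKu col_mxKd dotv0r add0r.
rewrite /gap /lagr.
have -> : usubmx (z + col_mx 0 d) = usubmx z.
  by apply/colP => i; have /colP/(_ i) := col_mxKu (0 : 'cV[R]_n) d; rewrite !mxE => ->; rewrite addr0.
have -> : dsubmx (z + col_mx 0 d) = dsubmx z + d.
  by have /colP H := col_mxKd (0 : 'cV[R]_n) d; apply/colP => i; have := H i; rewrite !mxE => ->.
rewrite dotvDl => h.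
have : dotv d d <= 0.
  by rewrite {1}/d dotvDl dotvNl (dotvC (affine _) d); move: h; rewrite (dotvC d); lra.
rewrite -sqr_enorm => dd; have /enorm_eq0/eqP : enorm d = 0.
  by apply/eqP; rewrite -sqrf_eq0 eq_le dd sqr_ge0.
by rewrite subr_eq0 => /eqP.
Qed.

End lagrangian.

(** * Convergence to a saddle point *)

Section convergence.
Context {R : realType} {n p : nat}.
Variables (phi : 'cV[R]_n -> R) (A : 'M[R]_(p, n)) (b : 'cV[R]_p).
Hypothesis cphi : convex phi.
Variables (xs : 'cV[R]_n) (ls : 'cV[R]_p) (c : R).
Hypothesis c0 : 0 < c.
Local Notation affine := (eq_constraint A b).
Local Notation lagr := (lagr phi A b).
Local Notation gap := (gap phi A b).
Hypothesis hxs : affine xs = 0.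
Hypothesis growth : forall x, phi xs + c * enorm (affine x) ^+ 2 <= lagr x ls.

Variable u : R -> 'cV[R]_(n + p).
Hypothesis su : evi_solution gap `[0, +oo[ u.

Let w0 := col_mx xs ls.
Let ew0 : evi_equilibrium gap w0.
Proof.
move=> z; apply: le_trans (gap_equilibrium_growth hxs growth z) _.
by rewrite oppr_le0 mulr_ge0 ?sqr_ge0// ltW.
Qed.
Let iJ : is_interval (`[0, +oo[%classic : set R). Proof. exact: interval_is_interval. Qed.
Let J0 (t : R) : 0 <= t -> (`[0, +oo[%classic : set R) t.
Proof. by move=> t0; rewrite /= in_itv/= andbT. Qed.

Let r := enorm w0 + enorm (u 0 - w0).

Let ur t : 0 <= t -> enorm (u t) <= r.
Proof.
move=> t0; have := evi_solution_fejer iJ su ew0 (J0 (lexx 0)) (J0 t0) t0.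
by have := ler_enormD (u t - w0) w0; rewrite subrK /r; lra.
Qed.

Lemma solution_lipschitz : exists2 M, 0 < M & forall s t, 0 <= s -> s <= t ->
  enorm (u t - u s) <= M * (t - s).
Proof.
have [M M0 MP] := evi_velocity_bounded r (gap_bounded A b cphi).
exists M => // s t s0 st.
apply: (evi_solution_lipschitz iJ su (ltW M0) MP) => //; last 2 first.
- exact: J0.
- by apply: J0; lra.
by move=> x; rewrite /= in_itv/= andbT; exact: ur.
Qed.

(** While the gap is below - e / 2 the squared distance to the saddle point
    decreases at rate at least e.  Along a Lipschitz curve the gap stays below
    - e / 2 for a fixed time d after each visit below - e, which costs e d; once
    the distance is within e d of its infimum this cannot happen again. *)
Lemma solution_gap_to_zero e : 0 < e -> exists2 T, 0 <= T & forall t, T <= t ->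
  - e < gap w0 (u t).
Proof.
move=> e0; have [M M0 MP] := solution_lipschitz.
have [K K0 KP] := gap_lipschitz A b cphi r w0.
pose d := e / (2 * (K * M + 1)).
have KM : 0 <= K * M by rewrite mulr_ge0// ltW.
have d0 : 0 < d by rewrite divr_gt0//; lra.
have dE : K * (M * d) <= e / 2.
  have : d * (2 * (K * M + 1)) = e by rewrite divfK// gt_eqF//; lra.
  lra.
pose E t := enorm (u t - w0) ^+ 2.
pose S := [set E t | t in `[0, +oo[%classic].
have infS : has_inf S.
  split; first by exists (E 0), 0 => //; exact: J0.
  by exists 0 => _ [t _ <-]; exact: sqr_ge0.
have ed : 0 < e * d by rewrite mulr_gt0.
have [_ [T /= T0 <-] ET] := inf_adherent ed infS.
rewrite in_itv/= andbT in T0.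
exists T => // t Tt; rewrite ltNge; apply/negP => ge.
have t0 : 0 <= t by exact: le_trans Tt.
have : E (t + d) - E t <= 2 * (- (e / 2)) * (t + d - t).
  apply: (evi_solution_dist_le iJ su) => [|||s /andP[ts sd]]; rewrite ?lerDl ?(ltW d0)//.
  - exact: J0.
  - by apply: J0; lra.
  have s0 : 0 <= s by exact: le_trans ts.
  have := KP _ _ (ur t0) (ur s0); have := ler_wpM2l K0 (MP _ _ t0 ts).
  have : M * (s - t) <= M * d by rewrite ler_pM2l//; lra.
  by move=> h; have := ler_wpM2l K0 h; lra.
have : E t <= E T.
  rewrite /E ler_pXn2r ?nnegrE ?enorm_ge0//.
  by apply: (evi_solution_fejer iJ su ew0) => //; exact: J0.
have : inf S <= E (t + d).
  by apply: ge_inf; [case: infS|exists (t + d) => //; apply: J0; lra].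
rewrite addrAC subrr add0r; lra.
Qed.

(** LaSalle's argument, run on long time windows.  At a cluster point z the gap
    vanishes, so its primal part is feasible and optimal.  If L (y, l) fell
    below the optimal value for the limit multiplier l, then over a time window
    of length tau beginning near z the squared distance to (y, l) would decrease
    at a fixed rate, as constraint violation and the motion of the multiplier
    are negligible there; for large tau it would become negative. *)
Theorem solution_converges_to_saddle : exists x l,
  [/\ affine x = 0, forall y, phi x <= lagr y l &
      forall e, 0 < e -> exists T, forall t, T <= t -> enorm (u t - col_mx x l) < e].
Proof.
have [U [UU ooU]] := ultraFilterLemma eventually_filter.
have ujr (j : nat) : enorm (u j%:R) <= r by apply: ur.
have [z zP] := bounded_ultralimit UU ujr.
have zr : enorm z <= r.
  rewrite -[z]subr0; apply: enorm_limit_le => e e0.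
  have [j /= jP] := filter_ex (zP e e0).
  exists (u j%:R), 0; split => //; first by rewrite subrr enorm0.
  by rewrite subr0; have := ujr j; lra.
have largeU (T : R) : U [set j : nat | T <= j%:R].
  by apply: ooU; exact: nbhs_infty_ger.
have [K K0 KP] := gap_lipschitz A b cphi r w0.
have gz : 0 <= gap w0 z.
  rewrite -oppr_le0; apply/ler_addgt0Pr => e e0; rewrite add0r.
  have [T T0 TP] := solution_gap_to_zero (e := e / 2) ltac:(lra).
  have eK : 0 < e / (2 * (K + 1)) by rewrite divr_gt0// mulr_gt0// ltr_wpDl.
  have [j [/= j1 j2]] := filter_ex (filterI (largeU T) (zP _ eK)).
  have := TP _ j1; have := KP _ _ zr (ujr j).
  move: j2; rewrite ltr_pdivlMr; last by rewrite mulr_gt0// ltr_wpDl.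
  by have := enorm_ge0 (u j%:R - z); lra.
set x := usubmx z; set l := dsubmx z.
have hx : affine x = 0.
  apply: enorm_eq0; apply/eqP; rewrite -sqrf_eq0 eq_le sqr_ge0 andbT.
  have := gap_equilibrium_growth hxs growth z; rewrite -/x => h.
  by rewrite -(pmulr_rle0 _ c0); lra.
have px : phi x <= phi xs.
  move: gz; rewrite /gap /w0 col_mxKu col_mxKd /lagr hxs -/x hx !dotv0r; lra.
have sad y : phi x <= lagr y l.
  apply: le_trans px _; rewrite leNgt -subr_lt0; apply/negP => V0.
  set V := lagr y l - phi xs in V0.
  set w := col_mx y l; pose Q := r + enorm w.
  have r0 : 0 <= r by rewrite addr_ge0 ?enorm_ge0.
  have nV : 0 < - V by lra.
  (* On the window the squared distance to w drops at rate - V from at most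
     Q ^ 2, so after time tau it would be negative. *)
  pose tau := Q ^+ 2 / - V + 1.
  have tau0 : 0 < tau by rewrite ltr_wpDl// divr_ge0 ?sqr_ge0 ?(ltW nV).
  have tauV : tau * V = - Q ^+ 2 + V by rewrite /tau; field; rewrite lt_eqF.
  have a1 : 0 < 3 * (enorm (ls - l) + tau * enorm (affine y) + 1).
    have := enorm_ge0 (ls - l); have := mulr_ge0 (ltW tau0) (enorm_ge0 (affine y)); lra.
  have a2 : 0 < 3 * (enorm (affine y) + 1) by have := enorm_ge0 (affine y); lra.
  (* Allowed constraint violation on the window, and allowed distance to z at
     its start: each makes an error of at most a third of - V / 2. *)
  set e1 := - V / 2 / (3 * (enorm (ls - l) + tau * enorm (affine y) + 1)).
  set e2 := - V / 2 / (3 * (enorm (affine y) + 1)).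
  have e10 : 0 < e1 by rewrite divr_gt0// divr_gt0.
  have e20 : 0 < e2 by rewrite divr_gt0// divr_gt0.
  have e1E : e1 * (3 * (enorm (ls - l) + tau * enorm (affine y) + 1)) = - V / 2.
    by rewrite divfK// gt_eqF.
  have e2E : e2 * (3 * (enorm (affine y) + 1)) = - V / 2 by rewrite divfK// gt_eqF.
  have [T T0 TP] := solution_gap_to_zero (mulr_gt0 c0 (exprn_gt0 2 e10)).
  have [j [/= Tj zj]] := filter_ex (filterI (largeU T) (zP _ e20)).
  set t : R := j%:R in Tj zj.
  have t0 : 0 <= t by exact: le_trans Tj.
  have hsmall s : t <= s -> enorm (affine (usubmx (u s))) <= e1.
    move=> ts; have := TP s (le_trans Tj ts).
    have := gap_equilibrium_growth hxs growth (u s); rewrite -/w0 => g1 g2.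
    rewrite -(@ler_pXn2r _ 2) ?nnegrE ?enorm_ge0 ?(ltW e10)// -(ler_pM2l c0); lra.
  have lsmall s : t <= s -> s <= t + tau ->
      enorm (dsubmx (u s) - dsubmx (u t)) <= tau * e1.
    move=> ts st; set d := dsubmx (u s) - dsubmx (u t).
    have [->|dn] := eqVneq (enorm d) 0; first by rewrite mulr_ge0 ?(ltW e10) ?(ltW tau0).
    have dp : 0 < enorm d by rewrite lt_def dn enorm_ge0.
    have : dotv (col_mx 0 d) (u s - u t) <= enorm d * e1 * (s - t).
      apply: (evi_solution_dotv_le iJ su) => //.
      - exact: J0.
      - by apply: J0; exact: le_trans ts.
      move=> t' v /andP[tt' _] /gap_velocity_dual vE.
      rewrite dotv_col col_mxKu col_mxKd dotvC dotv0r add0r vE.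
      by apply: le_trans (cauchy_schwarz _ _) _; rewrite ler_pM2l// hsmall.
    rewrite dotv_col col_mxKu col_mxKd dotvC dotv0r add0r dsubmxB -/d -sqr_enorm.
    rewrite expr2 -mulrA ler_pM2l// => /le_trans; apply.
    by rewrite mulrC ler_pM2r//; lra.
  have gapw s : t <= s <= t + tau -> gap w (u s) <= V / 2.
    move=> /andP[ts st].
    have -> : gap w (u s) = V + dotv (dsubmx (u s) - dsubmx (u t)) (affine y)
        + dotv (dsubmx (u t) - l) (affine y)
        + (phi xs - lagr (usubmx (u s)) ls)
        + dotv (ls - l) (affine (usubmx (u s))).
      rewrite /gap /w col_mxKu col_mxKd /V /lagr.
      move: (affine y) (affine (usubmx (u s))) => hy hs; rewrite !dotvE; ring.
    have h1 := hsmall s ts; have h2 := lsmall s ts st.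
    have h3 : enorm (dsubmx (u t) - l) <= e2.
      by rewrite /l -dsubmxB (le_trans (enorm_dsubmx _))// ltW.
    have := growth (usubmx (u s)).
    have : 0 <= c * enorm (affine (usubmx (u s))) ^+ 2 by rewrite mulr_ge0 ?sqr_ge0 ?(ltW c0).
    have := cauchy_schwarz (dsubmx (u s) - dsubmx (u t)) (affine y).
    have := cauchy_schwarz (dsubmx (u t) - l) (affine y).
    have := cauchy_schwarz (ls - l) (affine (usubmx (u s))).
    have := ler_wpM2r (enorm_ge0 (affine y)) h2.
    have := ler_wpM2r (enorm_ge0 (affine y)) h3.
    have := ler_wpM2l (enorm_ge0 (ls - l)) h1.
    lra.
  have : enorm (u (t + tau) - w) ^+ 2 - enorm (u t - w) ^+ 2 <= 2 * (V / 2) * (t + tau - t).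
    apply: (evi_solution_dist_le iJ su) => //; last by rewrite lerDl ltW.
    - exact: J0.
    - by apply: J0; lra.
  have : enorm (u t - w) ^+ 2 <= Q ^+ 2.
    rewrite ler_pXn2r ?nnegrE ?enorm_ge0 ?addr_ge0 ?enorm_ge0//.
    by rewrite (le_trans (ler_enormB _ _))// lerD2r ur.
  have := sqr_ge0 (enorm (u (t + tau) - w)).
  lra.
exists x, l; split => // e e0.
have [j /= jP] := filter_ex (zP e e0).
have ez := saddle_equilibrium hx sad.
exists j%:R => t jt; apply: le_lt_trans jP.
rewrite vsubmxK in ez *.
by apply: (evi_solution_fejer iJ su ez) => //; apply: J0 => //; exact: le_trans jt.
Qed.

End convergence.

(** * Block vectors and the saddle-point dynamics *)

Lemma approx_is_derive {R : realType} {V : normedModType R} (f : R -> V) (t : R) (v : V) :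
  (forall e, 0 < e -> exists2 d, 0 < d &
    forall s, `|s - t| < d -> `|f s - f t - (s - t) *: v| <= e * `|s - t|) ->
  is_derive (t : R^o) (1 : R^o) (f : R^o -> V) v.
Proof.
move=> H.
have cv : (fun h : R^o => h^-1 *: (f (h *: 1 + t) - f t)) @ (0 : R^o)^' --> v.
  apply/cvgrPdist_le => e e0; have [d d0 dP] := H e e0.
  rewrite near_withinE; exists d => // h /=; rewrite sub0r normrN => hd h0.
  have := dP (h + t); rewrite addrK => /(_ hd).
  rewrite -[h *: 1]/(h * 1) mulr1 => K.
  have -> : v - h^-1 *: (f (h + t) - f t) = - (h^-1 *: (f (h + t) - f t - h *: v)).
    by rewrite [in RHS]scalerBr scalerA mulVf// scale1r opprB.
  by rewrite normrN normrZ normfV mulrC ler_pdivrMr ?normr_gt0.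
by apply: DeriveDef; [apply/cvg_ex; exists v|exact/cvg_lim].
Qed.

Section pairs.
Context {R : realType} {n p : nat}.
Implicit Types (z : 'cV[R]_n * 'cV[R]_p).

Definition col_of_pair z : 'cV[R]_(n + p) := col_mx z.1 z.2.
Definition pair_of_col (w : 'cV[R]_(n + p)) := (usubmx w, dsubmx w).

Lemma col_of_pairK : cancel col_of_pair pair_of_col.
Proof. by move=> [x l]; rewrite /pair_of_col /col_of_pair col_mxKu col_mxKd. Qed.

Lemma pair_of_colK : cancel pair_of_col col_of_pair.
Proof. by move=> w; exact: vsubmxK. Qed.

Lemma col_of_pairB z z' : col_of_pair z - col_of_pair z' = col_of_pair (z - z').
Proof. by rewrite /col_of_pair opp_col_mx add_col_mx. Qed.

Lemma pnormE z : pnorm z = enorm (col_of_pair z).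
Proof. by rewrite /pnorm {3}/enorm dotv_col_mx !sqr_enorm. Qed.

Lemma ler_coord_norm m (x : 'cV[R]_m) i : `|x i 0| <= `|x|.
Proof.
rewrite [in leRHS]/Num.norm/= mx_normrE.
by apply: (le_bigmax _ (fun i : 'I_m * 'I_1 => `|x i.1 i.2|) (i, 0)).
Qed.

Lemma norm_le_coord m (x : 'cV[R]_m) e : 0 <= e -> (forall i, `|x i 0| <= e) -> `|x| <= e.
Proof.
move=> e0 H; rewrite [in leLHS]/Num.norm/= mx_normrE.
by apply: bigmax_le => // -[i j] _ /=; rewrite (ord1 j).
Qed.

Lemma col_of_pair_coord_le z i : `|col_of_pair z i 0| <= `|z|.
Proof.
rewrite prod_normE le_max /col_of_pair; have [j ->|j ->] := split_ordP i.
  by rewrite col_mxEu ler_coord_norm.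
by rewrite col_mxEd ler_coord_norm orbT.
Qed.

Lemma pair_norm_le z e : 0 <= e -> (forall i, `|col_of_pair z i 0| <= e) -> `|z| <= e.
Proof.
move=> e0 H; rewrite prod_normE ge_max; apply/andP; split; apply: norm_le_coord => // i.
  by have := H (lshift p i); rewrite col_mxEu.
by have := H (rshift n i); rewrite col_mxEd.
Qed.

Lemma col_of_pair_taylor z z' dz (h : R) i :
  col_of_pair (z - z' - h *: dz) i 0 =
  col_of_pair z i 0 - col_of_pair z' i 0 - h *: (col_of_pair dz i 0 : R^o).
Proof.
by have [j ->|j ->] := split_ordP i; rewrite /col_of_pair ?col_mxEu ?col_mxEd /= !mxE.
Qed.

Lemma has_velocity_of_pair (z : R -> 'cV[R]_n * 'cV[R]_p) (t : R) dz :
  is_derive (t : R^o) (1 : R^o) z dz ->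
  has_velocity (col_of_pair \o z) t (col_of_pair dz).
Proof.
move=> dzP i; apply: approx_is_derive => e e0.
have [d d0 dP] := is_derive_approx dzP e0.
exists d => // s sd; apply: le_trans (dP s sd).
by rewrite -[X in `|X|]col_of_pair_taylor col_of_pair_coord_le.
Qed.

Lemma is_derive_pair (z : R -> 'cV[R]_n * 'cV[R]_p) (t : R) dz :
  has_velocity (col_of_pair \o z) t (col_of_pair dz) ->
  is_derive (t : R^o) (1 : R^o) z dz.
Proof.
move=> H; apply: approx_is_derive => e e0.
have /choice[d dP] : forall i, exists d, 0 < d /\ forall s, `|s - t| < d ->
    `|col_of_pair (z s - z t - (s - t) *: dz) i 0| <= e * `|s - t|.
  move=> i; have [d d0 dP] := is_derive_approx (H i) e0.
  by exists d; split=> // s /dP; rewrite col_of_pair_taylor.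
exists (\big[Num.min/1]_i d i).
  by apply: lt_bigmin => // i _; have [] := dP i.
move=> s sd; apply: pair_norm_le => [|i]; first by rewrite mulr_ge0 ?(ltW e0).
by have [_] := dP i; apply; apply: lt_le_trans sd _; exact: bigmin_le_cond.
Qed.

End pairs.

Section transfer.
Context {R : realType} {n m p : nat}.
Variables (f : 'cV[R]_n -> R) (g : 'cV[R]_n -> 'cV[R]_m).
Variables (A : 'M[R]_(p, n)) (b : 'cV[R]_p) (mu kappa : R).

Definition primal (x : 'cV[R]_n) : R :=
  f x + 1 / (2 * mu) * enorm (eq_constraint A b x) ^+ 2
  + kappa * \sum_k Num.max 0 (g x k 0).

Local Notation L := (augmented_lagrangian f g A b mu kappa).
Local Notation gap := (gap primal A b).

Lemma augmented_lagrangianE x l : L x l = lagr primal A b x l.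
Proof. by rewrite /augmented_lagrangian /lagr /primal; ring. Qed.

Lemma convex_of_convex_function (phi : 'cV[R]_n -> R) :
  convex_function (E := 'cV[R]_n) [set: 'cV[R]_n] phi -> convex phi.
Proof.
move=> H x y t t01.
pose q : {i01 R} := Itv01 (proj1 (andP t01)) (proj2 (andP t01)).
have := H q x y (in_setT _) (in_setT _); exact.
Qed.

(** From left to right, the subgradient inequality is added to the identity
    <h x, l - l'> = L (x, l) - L (x, l').  Conversely, points w with the
    multiplier of z recover the subgradient inequality. *)
Lemma saddle_dynamics_velocity z dz : saddle_dynamics L z dz <->
  evi_velocity gap (col_of_pair z) (col_of_pair dz).
Proof.
rewrite /saddle_dynamics /= generalized_gradient_augmented_lagrangian.
split=> [[[xi xiP xiE] dz2] w|H].
  rewrite dotv_col !usubmxB !dsubmxB /gap !col_mxKu !col_mxKd.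
  have := xiP (usubmx w); rewrite /= !augmented_lagrangianE.
  rewrite -xiE dz2 -(opprB _ z.1) dotvNl dotvNr => h.
  have -> : dotv (eq_constraint A b z.1) (z.2 - dsubmx w) =
      lagr primal A b z.1 z.2 - lagr primal A b z.1 (dsubmx w).
    by rewrite dotvC dotvDl dotvNl /lagr; ring.
  lra.
have := gap_velocity_dual H; rewrite !col_mxKu !col_mxKd => ->; split => //.
exists (- dz.1); last by rewrite opprK.
move=> y /=; rewrite !augmented_lagrangianE.
have := H (col_mx y z.2); rewrite dotv_col !usubmxB !dsubmxB /gap !col_mxKu !col_mxKd.
by rewrite subrr dotv0r addr0 -(opprB y) dotvNl dotvNr; lra.
Qed.

Lemma evi_solution_of_solution J z : is_solution (saddle_dynamics L) J z ->
  evi_solution gap J (col_of_pair \o z).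
Proof.
move=> [_ ac d]; split.
  move=> a c Ja Jc e e0; have [del del0 H] := ac a c Ja Jc e e0.
  exists del => // k u v uv tr sd; apply: le_lt_trans (H k u v uv tr sd).
  by apply: ler_sum => i _; rewrite /enorm_incr /= col_of_pairB -pnormE.
apply: ae_lebesgueS d => t H Jt; have [dz ddz Fdz] := H Jt.
by exists (col_of_pair dz); [exact: has_velocity_of_pair|exact/saddle_dynamics_velocity].
Qed.

Lemma solution_of_evi_solution J u : is_interval J -> J 0 -> (forall t, J t -> 0 <= t) ->
  evi_solution gap J u -> is_solution (saddle_dynamics L) J (pair_of_col \o u).
Proof.
move=> iJ J0 Jpos [ac d]; split => //.
  move=> a c Ja Jc e e0; have [del del0 H] := ac a c Ja Jc e e0.
  exists del => // k x y xy tr sd; apply: le_lt_trans (H k x y xy tr sd).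
  by apply: ler_sum => i _; rewrite pnormE -col_of_pairB !pair_of_colK.
apply: ae_lebesgueS d => t H Jt; have [v dv Gv] := H Jt.
exists (pair_of_col v).
  apply: is_derive_pair; rewrite pair_of_colK.
  rewrite (_ : _ \o _ = u)//; apply/funext => s /=; exact: pair_of_colK.
by apply/saddle_dynamics_velocity; rewrite !pair_of_colK.
Qed.

Lemma saddle_points_equilibrium z : saddle_points L z ->
  evi_equilibrium gap (col_of_pair z).
Proof.
move=> zs w; rewrite /gap !col_mxKu !col_mxKd -!augmented_lagrangianE.
by have [h1 h2] := zs (usubmx w) (dsubmx w); lra.
Qed.

Lemma saddle_point_of_minimum x l : eq_constraint A b x = 0 ->
  (forall y, primal x <= lagr primal A b y l) -> saddle_points L (x, l).
Proof.
move=> hx H y l' /=; rewrite !augmented_lagrangianE.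
have E l'' : lagr primal A b x l'' = primal x.
  by rewrite /lagr hx dotv0r addr0.
by rewrite !E.
Qed.

End transfer.

(** * Exact penalty and asymptotic stability *)

Section program.
Context {R : realType} {n m p : nat}.
Variables (f : 'cV[R]_n -> R) (g : 'cV[R]_n -> 'cV[R]_m).
Variables (A : 'M[R]_(p, n)) (b : 'cV[R]_p) (mu kappa : R).

Lemma primal_convex : 0 < mu -> 0 <= kappa -> convex f ->
  (forall k, convex (fun x => g x k 0)) -> convex (primal f g A b mu kappa).
Proof.
move=> mu0 k0 cf cg; apply: convexD; first apply: convexD => //.
  by apply: convexZ; [rewrite divr_ge0// mulr_ge0// ltW|exact: convex_sqr_affine].
by apply: convexZ => //; apply: convex_sum => k; exact: convex_max0.
Qed.

(** Since 0 <= nu_k <= kappa, each term nu_k g_k is at most the penalty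
    kappa max (0, g_k), so the Lagrangian of the program, whose infimum is the
    optimal value, bounds the penalised one from below.  The quadratic penalty
    is left over as growth. *)
Lemma exact_penalty_growth (nu : 'cV[R]_m) xs :
  solution_set f g A b xs -> dual_solution f g A b nu -> `|nu| < kappa ->
  exists ls, forall x, primal f g A b mu kappa xs
    + 1 / (2 * mu) * enorm (eq_constraint A b x) ^+ 2 <= lagr (primal f g A b mu kappa) A b x ls.
Proof.
move=> [[hxs gxs] fxs] [nu0 [ls lsE]] nuk; exists ls => x.
have pxs : primal f g A b mu kappa xs = f xs.
  rewrite /primal hxs enorm0 expr0n mulr0 addr0 big1 ?mulr0 ?addr0// => k _.
  by rewrite max_l.
have dual : f xs <= f x + dotv ls (eq_constraint A b x) + dotv nu (g x).
  by rewrite -lee_fin fxs -lsE; apply: ereal_inf_lbound; exists x.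
have pen : dotv nu (g x) <= kappa * \sum_k Num.max 0 (g x k 0).
  rewrite mulr_sumr; apply: ler_sum => k _.
  have nk : nu k 0 <= kappa.
    by apply: le_trans (ltW nuk); apply: le_trans (ler_coord_norm _ k); exact: ler_norm.
  have := nu0 k; case: (leP 0 (g x k 0)) => gk nuk0; nra.
rewrite pxs /lagr /primal; lra.
Qed.

End program.

Theorem theorem3p3 (R : realType) (n m p : nat) (hpn : (p <= n)%N)
  (f : 'cV[R]_n -> R) (g : 'cV[R]_n -> 'cV[R]_m)
  (A : 'M[R]_(p, n)) (b : 'cV[R]_p)
  (hf : convex_function (E := 'cV[R]_n) [set: 'cV[R]_n] f)
  (hg : forall k : 'I_m,
     convex_function (E := 'cV[R]_n) [set: 'cV[R]_n] (fun x => g x k 0))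
  (hS0 : solution_set f g A b !=set0)
  (hSb : bounded_set (solution_set f g A b))
  (hslater : strong_slater g A b)
  (mu : R) (hmu : 0 < mu < 1)
  (nu : 'cV[R]_m) (hnu : dual_solution f g A b nu)
  (kappa : R) (hkappa : `|nu| < kappa) :
  let L := augmented_lagrangian f g A b mu kappa in
  strongly_globally_asymptotically_stable (saddle_dynamics L) (saddle_points L).
Proof.
move=> L.
have [mu0 _] := andP hmu.
have k0 : 0 <= kappa by exact: le_trans (normr_ge0 nu) (ltW hkappa).
pose phi := primal f g A b mu kappa.
have cphi : convex phi.
  apply: primal_convex => //; first exact: convex_of_convex_function.
  by move=> k; exact: convex_of_convex_function.
have [xs Sxs] := hS0; have hxs : eq_constraint A b xs = 0 by have [[]] := Sxs.
have [ls growth] := exact_penalty_growth mu Sxs hnu hkappa.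
have c0 : 0 < 1 / (2 * mu) by rewrite divr_gt0// mulr_gt0.
have fejer J z w s t : is_solution (saddle_dynamics L) J z -> saddle_points L w ->
    J s -> J t -> s <= t -> pnorm (z t - w) <= pnorm (z s - w).
  move=> sz /saddle_points_equilibrium ew Js Jt st.
  rewrite !pnormE -!col_of_pairB; have [[iJ _ _] _ _] := sz.
  exact: (evi_solution_fejer iJ (evi_solution_of_solution sz) ew Js Jt st).
have edist_le w z : saddle_points L w ->
    (edist_to (saddle_points L) z <= (pnorm (z - w))%:E)%E.
  by move=> Mw; apply: ereal_inf_lbound; exists w.
split=> [e e0|J z [sz maxz]].
  exists e => // J z sz /ereal_inf_lt[_ [w Mw <-]]; rewrite lte_fin => zw t Jt.
  have [[_ J0 Jpos] _ _] := sz.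
  apply: le_lt_trans (edist_le w _ Mw) _; rewrite lte_fin.
  by apply: le_lt_trans zw; exact: (fejer _ _ _ _ _ sz Mw J0 Jt (Jpos t Jt)).
have [[iJ J0 Jpos] _ _] := sz; have ez := evi_solution_of_solution sz.
have ew0 : evi_equilibrium (gap phi A b) (col_mx xs ls).
  apply: saddle_equilibrium => // y; apply: le_trans (growth y).
  by rewrite lerDl mulr_ge0 ?sqr_ge0 ?(ltW c0).
have [u u0 su] := evi_solution_exists (gap_bounded A b cphi) (gap_lipschitz A b cphi)
  (gap_resolvent cphi c0 growth) (col_of_pair (z 0)) ew0.
have uE t : J t -> u t = col_of_pair (z t).
  move=> Jt; have t0 := Jpos t Jt.
  have sub x : J x -> (`[0, +oo[%classic : set R) x.
    by move=> /Jpos; rewrite /= in_itv/= andbT.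
  have suJ := evi_solutionS sub su.
  exact: evi_solution_unique (gap_monotone phi A b) iJ suJ ez J0 Jt t0 u0.
have JE : J = `[0, +oo[%classic.
  apply/esym; apply: (maxz _ (pair_of_col \o u)).
  - apply: solution_of_evi_solution su.
    + exact: interval_is_interval.
    + by rewrite /= in_itv/= lexx.
    + by move=> t; rewrite /= in_itv/= andbT.
  - by move=> x /Jpos; rewrite /= in_itv/= andbT.
  - by move=> t Jt; rewrite /= uE// col_of_pairK.
split=> //; rewrite JE in ez.
have [x [l [hx xl conv]]] := solution_converges_to_saddle cphi c0 hxs growth ez.
have Mx : saddle_points L (x, l) by exact: saddle_point_of_minimum.
have dist0 : (pnorm (z t - (x, l)))%:E @[t --> +oo] --> (0 : R)%:E.
  apply: cvg_EFin; first exact: nearW.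
  apply/cvgrPdist_lt => e e0; have [T TP] := conv e e0.
  near=> t; rewrite /= sub0r normrN.
  have /ger0_norm -> : 0 <= pnorm (z t - (x, l)) by rewrite pnormE enorm_ge0.
  by rewrite pnormE -col_of_pairB; apply: TP; near: t; apply: nbhs_pinfty_ge; exact: num_real.
apply: squeeze_cvge (cvg_cst _) dist0.
apply: nearW => t; rewrite edist_le// andbT.
by apply: le_ereal_inf_tmp => _ [w _ <-]; rewrite lee_fin pnormE enorm_ge0.
Unshelve. all: by end_near. Qed.
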